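(* Let $M$ be a complex manifold with a volume form $\Omega'$ given in local holomorphic coordinates by $\Omega'=e^{-2\Phi_0'}dX^1\wedge\dots\wedge dX^n\wedge dX^{\bar 1}\wedge\dots\wedge dX^{\bar n}$ with $\partial_i\partial_{\bar j}\Phi_0'=0$. Consider the differential graded Lie algebra $\mathbf{F}^{\cdot}_{sm}|_{\mathbf{b}^-=0}$ with differential $\mathcal{Q}$ and bracket $\{\cdot,\cdot\}$, and let a degree $2$ element $\Psi$ of it be given by its components $(g,\bar v,v,\phi,\bar\phi)$, where $g\in\Gamma(T^{(1,0)}M\otimes T^{(0,1)}M)$, $\bar v\in\bar{\mathcal{O}}(T^{(0,1)}M)$, $v\in\mathcal{O}(T^{(1,0)}M)$, $\phi\in\mathcal{O}_M$, $\bar\phi\in\bar{\mathcal{O}}_M$. Put $\Phi_0=\Phi_0'+\phi-\bar\phi$, $f=-2\Phi_0$ and $\Omega=\Omega'e^{-2\phi+2\bar\phi}$. Then in the Maurer-Cartan equation $\mathcal{Q}\Psi+\frac12\{\Psi,\Psi\}=0$ the variables $v,\bar v$ are auxiliary (they are expressed through $g,\phi,\bar\phi$), and the equation imposes on $g,\phi,\bar\phi$ the following system of conditions: 1) The vector field $div_\Omega g$, where $\Omega$ is determined by $f=-2\Phi_0$ and $\partial_i\partial_{\bar j}\Phi_0=0$, is such that its $\Gamma(T^{(1,0)}M)$ and $\Gamma(T^{(0,1)}M)$ components are respectively holomorphic and antiholomorphic. 2) The bivector field $g$ satisfies $$[[g,g]]+\mathcal{L}_{div_\Omega(g)}g=0,$$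 where $\mathcal{L}_{div_\Omega(g)}$ is the Lie derivative along the vector field $div_\Omega g$. 3) $div_\Omega div_\Omega(g)=0$. Moreover, the infinitesimal symmetries $\Psi\to\Psi+\mathcal{Q}\Lambda+\{\Psi,\Lambda\}$ (with $\Lambda\in\mathbf{F}^1_{sm}$, $\mathbf{b}^-\Lambda=0$) of the Maurer-Cartan equation coincide with the infinitesimal holomorphic coordinate transformations of the volume form $\Omega$ and of the tensor $\{g^{i\bar j}\}$.
   Context: **Notation.** $\mathcal{O}_M$, $\mathcal{O}(T^{(1,0)}M)$ are holomorphic functions and holomorphic $(1,0)$ vector fields; $\bar{\mathcal{O}}_M$, $\bar{\mathcal{O}}(T^{(0,1)}M)$ are antiholomorphic functions and $(0,1)$ vector fields; $\Gamma$ denotes smooth sections. For $g,h\in\Gamma(T^{(1,0)}M\otimes T^{(0,1)}M)$, $$[[g,h]]^{k\bar l}=g^{i\bar j}\partial_i\partial_{\bar j}h^{k\bar l}+h^{i\bar j}\partial_i\partial_{\bar j}g^{k\bar l}-\partial_ig^{k\bar j}\partial_{\bar j}h^{i\bar l}-\partial_ih^{k\bar j}\partial_{\bar j}g^{i\bar l}.$$ For a volume form $\Omega=e^fdX^1\wedge\dots\wedge dX^n\wedge dX^{\bar1}\wedge\dots\wedge dX^{\bar n}$, the divergence of the bivector field $g$ is the vector field $div_\Omega g$ with $$(div_\Omega g)^{\bar j}=\partial_ig^{i\bar j}+\partial_if\,g^{i\bar j},\qquad (div_\Omega g)^i=\partial_{\bar j}g^{i\bar j}+\partial_{\bar j}f\,g^{i\bar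 j}.$$ When $\partial_i\partial_{\bar j}f=0$, condition $div_\Omega div_\Omega(g)=0$ means $(\partial_i+\partial_if)(\partial_{\bar j}+\partial_{\bar j}f)g^{i\bar j}=0$. **The complex $\mathcal{F}_{sm}$.** $$\mathcal{F}^0_{sm}=\mathbb{C}\ni u,\quad \mathcal{F}^1_{sm}=\mathcal{O}(T^{(1,0)}M)\oplus\mathbb{C}\ni(A,t),\quad \mathcal{F}^2_{sm}=\mathcal{O}(T^{(1,0)}M)\oplus\mathcal{O}_M\ni(\tilde A,\tilde t),\quad \mathcal{F}^3_{sm}=\mathcal{O}_M\ni\tilde u.$$ A tilde denotes the copy of a vector field or function placed in degree $2$ (degree $3$ for $\tilde u$). With $\mathrm{div}A=\partial_iA^i-2(\partial_i\Phi_0')A^i$ (the divergence with respect to $\Omega'$): - Differential: $Qu=0$, $Q(A,t)=(0,t-\frac12\mathrm{div}A)$, $Q(\tilde A,\tilde t)=\frac12\mathrm{div}\tilde A\in\mathcal{F}^3_{sm}$, $Q\tilde u=0$. - Product: $u\in\mathbb{C}$ acts by scalar multiplication; $(A_1,A_2)=-[A_1,A_2]$ in the vector field part of $\mathcal{F}^2_{sm}$; $(t_1,A_2)=-t_1A_2$ and $(A_1,t_2)=t_2A_1$ in the vector field part of $\mathcal{F}^2_{sm}$; $(t_1,t_2)=0$; $(A_1,\tilde t_2)=(\tilde t_2,A_1)=-A_1(\tilde t_2)$ and $(t_1,\tilde t_2)=(\tilde t_2,t_1)=-t_1\tilde t_2$ in $\mathcal{F}^3_{sm}$; $(A_1,\tilde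 A_2)=(\tilde A_2,A_1)=(t_1,\tilde A_2)=(\tilde A_2,t_1)=0$; products of total degree $>3$ vanish. - Operator $\mathbf{b}$ of degree $-1$: $\mathbf{b}u=0$, $\mathbf{b}(A,t)=t\in\mathcal{F}^0_{sm}$, $\mathbf{b}(\tilde A,\tilde t)=(-\tilde A,0)\in\mathcal{F}^1_{sm}$, $\mathbf{b}\tilde u=(0,-\tilde u)\in\mathcal{F}^2_{sm}$. $(\bar{\mathcal{F}}_{sm},\bar Q,\bar{\mathbf{b}})$ is the complex conjugate object. **The complex $\mathbf{F}_{sm}$.** $\mathbf{F}^{\cdot}_{sm}$ is the completed tensor product of $\mathcal{F}^{\cdot}_{sm}$ and $\bar{\mathcal{F}}^{\cdot}_{sm}$ (total grading), formed on infinite jets: tensor products of holomorphic with antiholomorphic objects are completed to smooth ones. Thus $\mathcal{O}_M\otimes\bar{\mathcal{O}}_M$ is replaced by smooth functions, $\mathcal{O}(T^{(1,0)}M)\otimes\bar{\mathcal{O}}(T^{(0,1)}M)$ by $\Gamma(T^{(1,0)}M\otimes T^{(0,1)}M)$, $\mathcal{O}(T^{(1,0)}M)\otimes\bar{\mathcal{O}}_M$ by $\Gamma(T^{(1,0)}M)$ and $\mathcal{O}_M\otimes\bar{\mathcal{O}}(T^{(0,1)}M)$ by $\Gamma(T^{(0,1)}M)$, while factors $\mathbb{C}$ leave the other factor unchanged. All operations extend from decomposable elements as (bi)differential operators, with the Koszul signs $$\mathcal{Q}(a\otimes\bar a)=Qa\otimes\bar a+(-1)^{|a|}a\otimes\bar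 Q\bar a,\qquad (a\otimes\bar a,\,c\otimes\bar c)=(-1)^{|\bar a||c|}(a,c)\otimes(\bar a,\bar c),$$ $$\mathbf{b}^-(a\otimes\bar a)=\mathbf{b}a\otimes\bar a-(-1)^{|a|}a\otimes\bar{\mathbf{b}}\bar a .$$ The bracket is $$(-1)^{|a_1|}\{a_1,a_2\}=\mathbf{b}^-(a_1,a_2)-(\mathbf{b}^-a_1,a_2)-(-1)^{|a_1|}(a_1,\mathbf{b}^-a_2).$$ The elements annihilated by $\mathbf{b}^-$ form the differential graded Lie algebra (with degree shifted by one) $\mathbf{F}^{\cdot}_{sm}|_{\mathbf{b}^-=0}$. **Components of $\Psi$.** Let $e=(0,1)\in\mathcal{F}^1_{sm}$ and $\bar e=(0,1)\in\bar{\mathcal{F}}^1_{sm}$. The degree $2$ elements with $\mathbf{b}^-\Psi=0$ are exactly $$\Psi=g+\tilde v\otimes1+v\otimes\bar e+1\otimes\tilde{\bar v}-e\otimes\bar v+\tilde\phi\otimes1+1\otimes\tilde{\bar\phi},$$ where $g\in\Gamma(T^{(1,0)}M\otimes T^{(0,1)}M)$ is viewed in the completion of $\mathcal{F}^1_{sm}\otimes\bar{\mathcal{F}}^1_{sm}$; this identifies $\Psi$ with $(g,\bar v,v,\phi,\bar\phi)$. **Infinitesimal holomorphic coordinate transformations** of $\Omega$ and $g$ are their changes by Lie derivatives along vector fields whose $(1,0)$ part is holomorphic and whose $(0,1)$ part is antiholomorphic. *)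

(* Defs.v *)
From HB Require Import structures.
From mathcomp Require Import all_boot all_order all_algebra complex.
From mathcomp Require Import all_classical all_reals all_analysis.

Set Implicit Arguments.
Unset Strict Implicit.
Unset Printing Implicit Defensive.

Import Order.TTheory GRing.Theory Num.Theory.
Import numFieldNormedType.Exports.
Local Open Scope classical_set_scope.
Local Open Scope ring_scope.

(** * Complex-valued calculus on open subsets of C^n

  C^n is represented by its underlying normed space R^n x R^n = 'rV[R]_(n + n):
  the entry [lshift n k] is the real part of the k-th complex coordinate and
  [rshift n k] its imaginary part. *)

Section Calculus.
Variables (R : realType) (n : nat).
Implicit Types (F : 'rV[R]_(n + n) -> R[i]) (U : set 'rV[R]_(n + n)).

Definition zcoord (k : 'I_n) (z : 'rV[R]_(n + n)) : R[i] :=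
  Complex (z 0 (lshift n k)) (z 0 (rshift n k)).

Definition re_part F : 'rV[R]_(n + n) -> R := fun z => complex.Re (F z).
Definition im_part F : 'rV[R]_(n + n) -> R := fun z => complex.Im (F z).

Definition rpartial (m : 'I_(n + n)) F : 'rV[R]_(n + n) -> R[i] :=
  fun z => Complex ('D_(delta_mx 0 m) (re_part F) z)
                   ('D_(delta_mx 0 m) (im_part F) z).

Fixpoint Cdiff (r : nat) U F : Prop :=
  (forall z, U z ->
     {for z, continuous (re_part F)} /\ {for z, continuous (im_part F)}) /\
  if r is r'.+1 then
    forall m : 'I_(n + n),
      (forall z, U z -> derivable (re_part F) z (delta_mx 0 m) /\
                        derivable (im_part F) z (delta_mx 0 m)) /\
      Cdiff r' U (rpartial m F)
  else True.

Definition smooth_on U F : Prop := forall r, Cdiff r U F.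

(* Wirtinger derivatives *)
Definition dz (k : 'I_n) F : 'rV[R]_(n + n) -> R[i] := fun z =>
  2^-1 * (rpartial (lshift n k) F z - 'i%C * rpartial (rshift n k) F z).
Definition dzbar (k : 'I_n) F : 'rV[R]_(n + n) -> R[i] := fun z =>
  2^-1 * (rpartial (lshift n k) F z + 'i%C * rpartial (rshift n k) F z).

Definition holomorphic_on U F : Prop :=
  smooth_on U F /\ forall k z, U z -> dzbar k F z = 0.

End Calculus.

Definition cexp (R : realType) (w : R[i]) : R[i] :=
  (expR (complex.Re w))%:C%C *
  Complex (cos (complex.Im w)) (sin (complex.Im w)).

(** * Complex manifolds of dimension n, given by a holomorphic atlas *)

Record complex_manifold (R : realType) (n : nat) := ComplexManifold {
  point :> topologicalType;
  point_hausdorff : hausdorff_space point;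
  point_second_countable : @second_countable point;
  chart : Type;
  dom : chart -> set point;
  cod : chart -> set 'rV[R]_(n + n);
  coord : chart -> point -> 'rV[R]_(n + n);
  coordV : chart -> 'rV[R]_(n + n) -> point;
  dom_open : forall a, open (dom a);
  cod_open : forall a, open (cod a);
  dom_cover : forall p, exists a, dom a p;
  coord_cod : forall a p, dom a p -> cod a (coord a p);
  coordV_dom : forall a z, cod a z -> dom a (coordV a z);
  coordK : forall a p, dom a p -> coordV a (coord a p) = p;
  coordVK : forall a z, cod a z -> coord a (coordV a z) = z;
  coord_continuous : forall a, {within dom a, continuous (coord a)};
  coordV_continuous : forall a, {within cod a, continuous (coordV a)};
  transition_holomorphic : forall a b (k : 'I_n),
    holomorphic_on [set z | cod a z /\ dom b (coordV a z)]
                   (fun z => zcoord k (coord b (coordV a z)))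
}.

(** * Functions and tensor fields in local coordinates

  Every object on M is given by its component functions in each chart; the
  values outside the range [cod a] of the chart are irrelevant, so equality of
  local functions is [eqM]. *)

Definition lfun (R : realType) (n : nat) (M : complex_manifold R n) : Type :=
  chart M -> 'rV[R]_(n + n) -> R[i].

Section Fields.
Variables (R : realType) (n : nat) (M : complex_manifold R n).
Implicit Types (h : lfun M) (A : 'I_n -> lfun M) (g : 'I_n -> 'I_n -> lfun M).

Definition eqM h1 h2 : Prop :=
  forall a z, cod a z -> h1 a z = h2 a z.

Definition pd (k : 'I_n) h : lfun M := fun a => dz k (h a).
Definition pdbar (k : 'I_n) h : lfun M := fun a => dzbar k (h a).

Definition jac (a b : chart M) (z : 'rV[R]_(n + n)) : 'M[R[i]]_n :=
  \matrix_(i, k) dz k (fun w => zcoord i (coord b (coordV a w))) z.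

Definition smoothM h : Prop := forall a, smooth_on (cod a) (h a).

Definition smooth_fun h : Prop :=
  smoothM h /\
  forall a b p, dom a p -> dom b p -> h b (coord b p) = h a (coord a p).

Definition smooth_vf10 A : Prop :=
  (forall i, smoothM (A i)) /\
  forall a b p i, dom a p -> dom b p ->
    A i b (coord b p) =
    \sum_(k < n) jac a b (coord a p) i k * A k a (coord a p).

Definition smooth_vf01 A : Prop :=
  (forall i, smoothM (A i)) /\
  forall a b p i, dom a p -> dom b p ->
    A i b (coord b p) =
    \sum_(k < n) conjc (jac a b (coord a p) i k) * A k a (coord a p).

Definition smooth_bivector g : Prop :=
  (forall i j, smoothM (g i j)) /\
  forall a b p i j, dom a p -> dom b p ->
    g i j b (coord b p) =
    \sum_(k < n) \sum_(l < n)
      jac a b (coord a p) i k * conjc (jac a b (coord a p) j l) *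
      g k l a (coord a p).

Definition is_hol h : Prop := forall k, eqM (pdbar k h) 0.
Definition is_antihol h : Prop := forall k, eqM (pd k h) 0.

Definition hol_fun h : Prop := smooth_fun h /\ is_hol h.
Definition antihol_fun h : Prop := smooth_fun h /\ is_antihol h.
Definition hol_vf A : Prop := smooth_vf10 A /\ forall i, is_hol (A i).
Definition antihol_vf A : Prop := smooth_vf01 A /\ forall i, is_antihol (A i).

(** ** Volume forms, divergences, the bracket [[g, h]], Lie derivatives *)

(* e^{-2 Phi} dX^1 ... dX^n dX^{bar 1} ... dX^{bar n} is a nowhere vanishing
   smooth (n,n)-form; Phi is complex valued and depends on the chart. *)
Definition volume_potential (Phi : lfun M) : Prop :=
  smoothM Phi /\
  forall a b p, dom a p -> dom b p ->
    cexp (- 2 * Phi a (coord a p)) =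
    cexp (- 2 * Phi b (coord b p)) *
    (\det (jac a b (coord a p)) * conjc (\det (jac a b (coord a p)))).

Definition pluriharmonic (Phi : lfun M) : Prop :=
  forall i j, eqM (pd i (pdbar j Phi)) 0.

(* In the divergences, f is the logarithm of the density of the volume form. *)
Definition div10 (f : lfun M) A : lfun M :=
  \sum_(i < n) (pd i (A i) + pd i f * A i).
Definition div01 (f : lfun M) A : lfun M :=
  \sum_(j < n) (pdbar j (A j) + pdbar j f * A j).

(* A complex vector field has components indexed by 'I_n + 'I_n: the (1,0)
   components are the [inl i], the (0,1) components the [inr j]. *)
Definition divg (f : lfun M) g (I : 'I_n + 'I_n) : lfun M :=
  match I with
  | inl i => div01 f (fun j => g i j)
  | inr j => div10 f (fun i => g i j)
  end.

Definition divdivg (f : lfun M) g : lfun M :=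
  div10 f (fun i => div01 f (fun j => g i j)).

Definition dbracket (g h : 'I_n -> 'I_n -> lfun M) (k l : 'I_n) : lfun M :=
  \sum_(i < n) \sum_(j < n)
    (g i j * pd i (pdbar j (h k l)) + h i j * pd i (pdbar j (g k l))
     - pd i (g k j) * pdbar j (h i l) - pd i (h k j) * pdbar j (g i l)).

Definition pdC (K : 'I_n + 'I_n) h : lfun M :=
  match K with inl i => pd i h | inr j => pdbar j h end.

Definition bivec g (I J : 'I_n + 'I_n) : lfun M :=
  match I, J with inl i, inr j => g i j | _, _ => 0 end.

Definition lie_bivec (X : 'I_n + 'I_n -> lfun M)
    (T : 'I_n + 'I_n -> 'I_n + 'I_n -> lfun M) (I J : 'I_n + 'I_n) : lfun M :=
  \sum_(K : 'I_n + 'I_n)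
    (X K * pdC K (T I J) - pdC K (X I) * T K J - pdC K (X J) * T I K).

(* density of the Lie derivative of the top-degree form of density w *)
Definition lie_vol (X : 'I_n + 'I_n -> lfun M) (w : lfun M) : lfun M :=
  \sum_(K : 'I_n + 'I_n) pdC K (X K * w).

Definition hol_transformation (X : 'I_n + 'I_n -> lfun M) : Prop :=
  hol_vf (fun i => X (inl i)) /\ antihol_vf (fun j => X (inr j)).

Definition density (f : lfun M) : lfun M := fun a z => cexp (f a z).

End Fields.

(** * The chiral complex

  [slot n] indexes the components of an element of F_sm: [su] for u (degree 0),
  [sA k] and [st] for (A^k, t) (degree 1), [sA2 k] and [st2] for the tilded
  (A^k, t) (degree 2), [su2] for the tilded u (degree 3). *)

Inductive slot (n : nat) : Type :=
  | su | sA of 'I_n | st | sA2 of 'I_n | st2 | su2.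
Arguments su {n}. Arguments sA {n}. Arguments st {n}.
Arguments sA2 {n}. Arguments st2 {n}. Arguments su2 {n}.

Definition sdeg (n : nat) (s : slot n) : nat :=
  match s with
  | su => 0 | sA _ => 1 | st => 1 | sA2 _ => 2 | st2 => 2 | su2 => 3
  end%N.

Section Chiral.
Variables (R : realType) (n : nat).

Definition chQ (V : lmodType R[i]) (div : ('I_n -> V) -> V)
    (x : slot n -> V) : slot n -> V := fun s =>
  match s with
  | st2 => x st - 2^-1 *: div (fun k => x (sA k))
  | su2 => 2^-1 *: div (fun k => x (sA2 k))
  | _ => 0
  end.

Definition chb (V : zmodType) (x : slot n -> V) : slot n -> V := fun s =>
  match s with
  | su => x st
  | sA k => - x (sA2 k)
  | st2 => - x su2
  | _ => 0
  end.

(* The product as a bidifferential operator, with coefficients multiplied by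
   an arbitrary bilinear [mul] and differentiated by [d].  Taking [mul] to be
   the conjugate product gives the operator on the completed tensor product. *)
Definition chprod (V : zmodType) (mul : V -> V -> V) (d : 'I_n -> V -> V)
    (x y : slot n -> V) : slot n -> V := fun s =>
  match s with
  | su => mul (x su) (y su)
  | sA k => mul (x su) (y (sA k)) + mul (x (sA k)) (y su)
  | st => mul (x su) (y st) + mul (x st) (y su)
  | sA2 k =>
      mul (x su) (y (sA2 k)) + mul (x (sA2 k)) (y su)
      - \sum_(i < n) (mul (x (sA i)) (d i (y (sA k)))
                      - mul (d i (x (sA k))) (y (sA i)))
      - mul (x st) (y (sA k)) + mul (x (sA k)) (y st)
  | st2 => mul (x su) (y st2) + mul (x st2) (y su)
  | su2 =>
      mul (x su) (y su2) + mul (x su2) (y su)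
      - \sum_(i < n) mul (x (sA i)) (d i (y st2))
      - \sum_(i < n) mul (d i (x st2)) (y (sA i))
      - mul (x st) (y st2) - mul (x st2) (y st)
  end.

End Chiral.

(** * The completed tensor product

  [x a b] is the component of x in (slot a of F_sm) (x) (slot b of its
  conjugate), as a local function. *)

Definition bfam (R : realType) (n : nat) (M : complex_manifold R n) : Type :=
  slot n -> slot n -> lfun M.

Definition scalar_slot (n : nat) (s : slot n) : bool :=
  match s with sA _ | sA2 _ => false | _ => true end.
(* the slots whose coefficients are complex constants *)
Definition const_slot (n : nat) (s : slot n) : bool :=
  match s with su | st => true | _ => false end.
Definition vector_block (n : nat) (c : 'I_n -> slot n) : Prop :=
  c = sA \/ c = sA2.

Section Tensor.
Variables (R : realType) (n : nat) (M : complex_manifold R n).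
Implicit Types (x y Psi Lam : bfam M).

Definition bzero x : Prop := forall a b, eqM (x a b) 0.

(* membership of x in the degree k part of the completed tensor product *)
Definition in_F (k : nat) x : Prop :=
  (forall a b, (sdeg a + sdeg b)%N != k -> eqM (x a b) 0) /\
  (forall a b, scalar_slot a -> scalar_slot b -> smooth_fun (x a b)) /\
  (forall c b, vector_block c -> scalar_slot b ->
     smooth_vf10 (fun i => x (c i) b)) /\
  (forall a c, scalar_slot a -> vector_block c ->
     smooth_vf01 (fun j => x a (c j))) /\
  (forall c c', vector_block c -> vector_block c' ->
     smooth_bivector (fun i j => x (c i) (c' j))) /\
  (forall a b, const_slot a -> is_antihol (x a b)) /\
  (forall a b, const_slot b -> is_hol (x a b)) /\
  (forall a b, const_slot a -> const_slot b ->
     exists c : R[i], eqM (x a b) (fun _ _ => c)).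

(* f is the logarithm of the density of Omega' *)
Definition bQ (f : lfun M) x : bfam M := fun a b =>
  chQ (div10 f) (fun a' => x a' b) a
  + (-1) ^+ sdeg a *: chQ (div01 f) (x a) b.

Definition bminus x : bfam M := fun a b =>
  chb (fun a' => x a' b) a - (-1) ^+ sdeg a *: chb (x a) b.

(* The sum over q splits y according to its holomorphic degree |c| = q, in
   order to apply the Koszul sign (-1)^(|b| |c|). *)
Definition bprod x y : bfam M :=
  \sum_(q < 4)
    chprod (chprod (fun h1 h2 : lfun M => h1 * h2) (@pdbar R n M))
           (fun i (u : slot n -> lfun M) b => pd i (u b))
           (fun a b => (-1) ^+ (sdeg b * q) *: x a b)
           (fun a b => if sdeg a == q then y a b else 0).

(* k is the degree of x *)
Definition bbracket (k : nat) x y : bfam M :=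
  (-1) ^+ k *:
    (bminus (bprod x y) - bprod (bminus x) y
     - (-1) ^+ k *: bprod x (bminus y)).

Definition maurer_cartan (f : lfun M) Psi : Prop :=
  bzero (bQ f Psi + 2^-1 *: bbracket 2 Psi Psi).

(* degree 2 elements annihilated by [bminus], by components *)
Definition mkPsi (g : 'I_n -> 'I_n -> lfun M) (vbar v : 'I_n -> lfun M)
    (phi phibar : lfun M) : bfam M := fun a b =>
  match a, b with
  | sA k, sA l => g k l
  | sA2 k, su => v k
  | sA k, st => v k
  | su, sA2 l => vbar l
  | st, sA l => - vbar l
  | st2, su => phi
  | su, st2 => phibar
  | _, _ => 0
  end.

Definition g_comp Psi (k l : 'I_n) : lfun M := Psi (sA k) (sA l).
Definition phi_comp Psi : lfun M := Psi st2 su.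
Definition phibar_comp Psi : lfun M := Psi su st2.

(* the increment of Psi (of degree 2) under the symmetry generated by Lam *)
Definition symmetry (f : lfun M) Lam Psi : bfam M :=
  bQ f Lam + bbracket 2 Psi Lam.

(* f = -2 Phi_0 *)
Definition log_density (Phi0' phi phibar : lfun M) : lfun M :=
  (- 2) *: (Phi0' + phi - phibar).

(* first-order variation of the density of Omega along (dphi, dphibar) *)
Definition density_variation (Phi0' phi phibar dphi dphibar : lfun M) : lfun M :=
  fun a z =>
    let w (e : R) := density (log_density Phi0' (phi + e%:C%C *: dphi)
                                          (phibar + e%:C%C *: dphibar)) a z in
    Complex (derive1 (fun e => complex.Re (w e)) 0)
            (derive1 (fun e => complex.Im (w e)) 0).

End Tensor.

(* Main.v *)
Require Import Defs.
From HB Require Import structures.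
From mathcomp Require Import all_boot all_order all_algebra complex.
From mathcomp Require Import all_classical all_reals all_analysis.
From mathcomp Require Import ring lra.

Set Implicit Arguments.
Unset Strict Implicit.
Unset Printing Implicit Defensive.

Import Order.TTheory GRing.Theory Num.Theory.
Import numFieldNormedType.Exports.
Local Open Scope ring_scope.

(** Both halves of the theorem come from writing out, component by component,
    the action of [bminus] on a product.  Since [bminus] kills [Psi] and the
    parameter [Lam] of a symmetry, the bracket is [bminus] of the product:
    {Psi, Psi} = b^-(Psi, Psi) and {Psi, Lam} = b^-(Psi, Lam).  A product is
    handled row by row: for a fixed slot of the holomorphic factor, the
    components along the antiholomorphic factor form an element of the
    antiholomorphic complex with smooth coefficients, homogeneous of degree 0,
    1, 2 or 3 in all the cases at hand ([arow0] to [arow3]), and the product of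
    two such rows is given by a short table ([cmul_arow00] and the following).

    Maurer-Cartan equation.  The terms of b^-(Psi, Psi) containing the product
    v phibar, phi vbar or v vbar cancel.  What remains of the equation
    ([maurer_cartan_table], [maurer_cartanP]) is
    - in bidegrees (1, 2) and (2, 1), vector times scalar:
      v is half the (1, 0) part of div_Omega g and vbar minus half its (0, 1)
      part, where the derivatives of phi and phibar contributed by the bracket
      turn the divergence for Omega', contributed by the differential, into the
      divergence for Omega;
    - in bidegrees (3, 0) and (0, 3), and again in the scalar parts of (2, 1)
      and (1, 2): div_Omega v = 0 and div_Omega vbar = 0;
    - in bidegrees (1, 2) and (2, 1), vector times vector: the vanishing of
      [[g, g]] plus the Lie derivative of g along 2 v - 2 vbar ([defect_lie]),
      which is condition 2 once v and vbar are expressed through g.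
    That v is holomorphic and vbar antiholomorphic is then condition 1, and
    div_Omega v = 0 is condition 3.  The latter is equivalent to
    div_Omega vbar = 0, since the holomorphic and antiholomorphic divergences
    commute: log Omega is pluriharmonic and mixed partial derivatives are
    symmetric ([div_comm], resting on [mixed_partials]).

    Symmetries.  An element of degree 1 killed by [bminus] consists of a
    holomorphic vector field A, an antiholomorphic one Abar and one constant t
    occurring twice.  The symmetry changes g by its Lie derivative along
    A - Abar ([symmetry_g]); it changes phi and phibar by halves of the
    divergences of A and Abar, up to sign and up to t ([symmetry_phi],
    [symmetry_phibar]).  In phi - phibar the constant cancels, and the logarithm of
    the density changes by div_Omega (A - Abar), that is, Omega changes by its Lie
    derivative along A - Abar. *)

(** * Directional derivatives of complex-valued functions *)
Section ComplexDerivative.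
Variables (R : realType) (V : normedModType R).
Implicit Types (f g : V -> R) (F G : V -> R[i]) (z v w : V) (d c : R[i]).

Lemma Re_mul (x y : R[i]) :
  complex.Re (x * y) = complex.Re x * complex.Re y - complex.Im x * complex.Im y.
Proof. by case: x y => [a b] [c d]. Qed.

Lemma Im_mul (x y : R[i]) :
  complex.Im (x * y) = complex.Re x * complex.Im y + complex.Im x * complex.Re y.
Proof. by case: x y => [a b] [c d]. Qed.

Lemma Re_add (x y : R[i]) : complex.Re (x + y) = complex.Re x + complex.Re y.
Proof. by case: x y => [a b] [c d]. Qed.

Lemma Im_add (x y : R[i]) : complex.Im (x + y) = complex.Im x + complex.Im y.
Proof. by case: x y => [a b] [c d]. Qed.

Let scaleRE (x y : R) : x *: y = x * y :> R. Proof. by []. Qed.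

(** The difference quotients of both sides are the same function; this reduces
    the chain rule and the mean value theorem along a direction to one real
    variable. *)
Lemma is_derive_line f v w (x d : R) :
  is_derive (x *: v + w) v f d <-> is_derive x 1 (fun h => f (h *: v + w)) d.
Proof.
have E : (fun h : R => h^-1 *: ((f \o shift (x *: v + w)) (h *: v) - f (x *: v + w)))
       = (fun h : R => h^-1 *: (((fun h => f (h *: v + w)) \o shift x) (h *: (1 : R^o))
                        - f (x *: v + w))).
  by apply/funext => h /=; rewrite [h *: 1]mulr1 scalerDl addrA.
by split=> -[D1 D2]; split; move: D1 D2; rewrite /derivable /derive E.
Qed.

Lemma is_derive_chain f v z (g : R -> R) (df dg : R) :
  is_derive z v f df -> is_derive (f z) 1 g dg ->
  is_derive z v (g \o f) (dg * df).
Proof.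
have <- : 0 *: v + z = z by rewrite scale0r add0r.
move=> /is_derive_line df0 dg0; apply/is_derive_line.
exact: (@is_derive1_comp _ g (fun h => f (h *: v + z)) 0).
Qed.

Definition is_cderive z v F d : Prop :=
  is_derive z v (fun w => complex.Re (F w)) (complex.Re d) /\
  is_derive z v (fun w => complex.Im (F w)) (complex.Im d).

Lemma is_cderive_lin z v F G (c dF dG : R[i]) :
  is_cderive z v F dF -> is_cderive z v G dG ->
  is_cderive z v (fun w => c * F w + G w) (c * dF + dG).
Proof.
move=> [F1 F2] [G1 G2]; split.
- rewrite (_ : (fun w => _) = complex.Re c *: (fun w => complex.Re (F w))
      - complex.Im c *: (fun w => complex.Im (F w)) + (fun w => complex.Re (G w))).
    rewrite Re_add Re_mul.
    exact: (is_deriveD (is_deriveB (is_deriveZ _ F1) (is_deriveZ _ F2)) G1).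
  by apply/funext => w; rewrite Re_add Re_mul.
- rewrite (_ : (fun w => _) = complex.Re c *: (fun w => complex.Im (F w))
      + complex.Im c *: (fun w => complex.Re (F w)) + (fun w => complex.Im (G w))).
    rewrite Im_add Im_mul.
    exact: (is_deriveD (is_deriveD (is_deriveZ _ F2) (is_deriveZ _ F1)) G2).
  by apply/funext => w; rewrite Im_add Im_mul.
Qed.

Lemma is_cderive_mul z v F G (dF dG : R[i]) :
  is_cderive z v F dF -> is_cderive z v G dG ->
  is_cderive z v (fun w => F w * G w) (dF * G z + F z * dG).
Proof.
move=> [F1 F2] [G1 G2]; split.
- rewrite (_ : (fun w => _) = (fun w => complex.Re (F w)) * (fun w => complex.Re (G w))
      - (fun w => complex.Im (F w)) * (fun w => complex.Im (G w))).
    apply: (is_derive_eq (is_deriveB (is_deriveM F1 G1) (is_deriveM F2 G2))).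
    by rewrite Re_add !Re_mul !scaleRE; ring.
  by apply/funext => w; rewrite Re_mul.
- rewrite (_ : (fun w => _) = (fun w => complex.Re (F w)) * (fun w => complex.Im (G w))
      + (fun w => complex.Im (F w)) * (fun w => complex.Re (G w))).
    apply: (is_derive_eq (is_deriveD (is_deriveM F1 G2) (is_deriveM F2 G1))).
    by rewrite Im_add !Im_mul !scaleRE; ring.
  by apply/funext => w; rewrite Im_mul.
Qed.

Lemma is_cderive_cexp z v F (dF : R[i]) :
  is_cderive z v F dF ->
  is_cderive z v (fun w => cexp (F w)) (cexp (F z) * dF).
Proof.
move=> [F1 F2].
have E := is_derive_chain F1 (is_derive_expR _).
have C := is_derive_chain F2 (is_derive_cos _).
have S := is_derive_chain F2 (is_derive_sin _).
split.
- rewrite (_ : (fun w => _) =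
     (expR \o (fun w => complex.Re (F w))) * (cos \o (fun w => complex.Im (F w)))).
    apply: (is_derive_eq (is_deriveM E C)).
    by rewrite Re_mul /cexp Re_mul Im_mul !scaleRE /=; ring.
  by apply/funext => w; rewrite /cexp Re_mul /= mul0r subr0.
- rewrite (_ : (fun w => _) =
     (expR \o (fun w => complex.Re (F w))) * (sin \o (fun w => complex.Im (F w)))).
    apply: (is_derive_eq (is_deriveM E S)).
    by rewrite Im_mul /cexp Re_mul Im_mul !scaleRE /=; ring.
  by apply/funext => w; rewrite /cexp Im_mul /= mul0r addr0.
Qed.

End ComplexDerivative.

(** * Symmetry of mixed second derivatives *)
Section MixedPartials.
Local Open Scope classical_set_scope.
Variables (R : realType) (V : normedModType R).
Implicit Types (f : V -> R) (a b z w : V).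

(** Two applications of the mean value theorem, first along [a] to
    x |-> f (x a + e b + z) - f (x a + z), then along [b] to the derivative of
    f in the direction [a]. *)
Lemma second_difference f a b z (e : R) : 0 < e ->
  (forall x y, 0 <= x <= e -> 0 <= y <= e ->
     derivable f (x *: a + (y *: b + z)) a /\
     derivable ('D_a f) (x *: a + (y *: b + z)) b) ->
  exists x y, [/\ 0 <= x <= e, 0 <= y <= e &
    f (e *: a + (e *: b + z)) - f (e *: a + z) - f (e *: b + z) + f z =
    'D_b ('D_a f) (x *: a + (y *: b + z)) * e ^+ 2].
Proof.
move=> e0 D.
have le0e : 0 <= (0 : R) <= e by rewrite lexx ltW.
have leee : 0 <= e <= e by rewrite lexx ltW.
pose p h := f (h *: a + (e *: b + z)) - f (h *: a + z).
have dp x : 0 <= x <= e ->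
    is_derive x 1 p ('D_a f (x *: a + (e *: b + z)) - 'D_a f (x *: a + z)).
  move=> xe.
  have [Ha _] := D x e xe leee; have [Hb _] := D x 0 xe le0e.
  rewrite scale0r add0r in Hb.
  exact: (is_deriveB ((is_derive_line _ _ _ _ _).1 (derivableP Ha))
                     ((is_derive_line _ _ _ _ _).1 (derivableP Hb))).
case: (@MVT_segment R p (fun x =>
    'D_a f (x *: a + (e *: b + z)) - 'D_a f (x *: a + z)) 0 e (ltW e0)).
- move=> x /[!in_itv]/= /andP[x0 xe]; apply: dp; by rewrite !ltW.
- apply: derivable_within_continuous => x /[!in_itv]/= xe.
  by have [] := dp x xe.
move=> x /[!in_itv]/= xe; rewrite subr0 => Ep.
pose q h := 'D_a f (h *: b + (x *: a + z)).
have dq y : 0 <= y <= e ->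
    is_derive y 1 q ('D_b ('D_a f) (x *: a + (y *: b + z))).
  move=> ye; have [_] := D x y xe ye; rewrite addrCA => /derivableP.
  by move=> /(is_derive_line _ _ _ _ _).1.
case: (@MVT_segment R q (fun y => 'D_b ('D_a f) (x *: a + (y *: b + z)))
  0 e (ltW e0)).
- move=> y /[!in_itv]/= /andP[y0 ye]; apply: dq; by rewrite !ltW.
- apply: derivable_within_continuous => y /[!in_itv]/= ye.
  by have [] := dq y ye.
move=> y /[!in_itv]/= ye; rewrite subr0 => Eq.
exists x, y; split => //.
rewrite expr2 mulrA -{}Eq /q (addrCA (e *: b)) scale0r add0r -{}Ep /p.
by rewrite scale0r !add0r; ring.
Qed.

Lemma near_square a b z (P : V -> Prop) : (\forall w \near z, P w) ->
  exists2 e : R, 0 < e & forall x y, 0 <= x <= e -> 0 <= y <= e ->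
    P (x *: a + (y *: b + z)).
Proof.
move=> /nbhs_ballP[d /= d0 dP].
pose e := d / (1 + `|a| + `|b|).
have s0 : 0 < 1 + `|a| + `|b| by rewrite -addrA ltr_pwDl ?addr_ge0.
exists e; first exact: divr_gt0.
move=> x y /andP[x0 xe] /andP[y0 ye]; apply: dP.
rewrite -ball_normE /ball_ /= addrA opprD addrCA subrr addr0 normrN.
have xa : `|x *: a| <= e * `|a| by rewrite normrZ ger0_norm // ler_wpM2r.
have yb : `|y *: b| <= e * `|b| by rewrite normrZ ger0_norm // ler_wpM2r.
rewrite (le_lt_trans (ler_normD _ _))// (le_lt_trans (lerD xa yb))//.
have -> : d = e * (1 + `|a| + `|b|) by rewrite /e divfK ?gt_eqF.
have : 0 < e by exact: divr_gt0.
by move=> ?; lra.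
Qed.

(** The second difference of f over a small square is symmetric in [a] and
    [b], so by the mean value theorem the two mixed derivatives take a common value
    at points arbitrarily close to [z]; by continuity they agree at [z]. *)
Lemma mixed_partials a b z f (U : set V) : open U -> U z ->
  (forall w, U w -> derivable f w a /\ derivable f w b) ->
  (forall w, U w -> derivable ('D_a f) w b /\ derivable ('D_b f) w a) ->
  {for z, continuous ('D_b ('D_a f))} -> {for z, continuous ('D_a ('D_b f))} ->
  'D_b ('D_a f) z = 'D_a ('D_b f) z.
Proof.
move=> oU Uz D1 D2 Cab Cba.
apply/eqP; rewrite -subr_eq0 -normr_eq0; apply/negPn/negP => N.
set d := `|_| in N.
have d0 : 0 < d / 2 by rewrite divr_gt0 // lt_neqAle eq_sym N normr_ge0.
have UN : \forall w \near z, [/\ U w, `|'D_b ('D_a f) z - 'D_b ('D_a f) w| < d / 2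
    & `|'D_a ('D_b f) z - 'D_a ('D_b f) w| < d / 2].
  have N1 := open_nbhs_nbhs (conj oU Uz).
  have N2 : \forall w \near z, `|'D_b ('D_a f) z - 'D_b ('D_a f) w| < d / 2.
    by move/cvgrPdist_lt: Cab; apply.
  have N3 : \forall w \near z, `|'D_a ('D_b f) z - 'D_a ('D_b f) w| < d / 2.
    by move/cvgrPdist_lt: Cba; apply.
  by apply: filterS3 N1 N2 N3 => w.
have [e e0 sq] := near_square a b UN.
have [|x [y [xe ye Exy]]] := @second_difference f a b z e e0.
  move=> x y xe ye; have [Uw _ _] := sq x y xe ye.
  exact: conj (D1 _ Uw).1 (D2 _ Uw).1.
have [|y' [x' [ye' xe' Eyx]]] := @second_difference f b a z e e0.
  move=> y' x' ye' xe'; rewrite addrCA; have [Uw _ _] := sq x' y' xe' ye'.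
  exact: conj (D1 _ Uw).2 (D2 _ Uw).2.
have [_ Hp _] := sq x y xe ye; have [_ _ Hq] := sq x' y' xe' ye'.
rewrite (addrCA (y' *: b)) in Eyx.
move: Exy Eyx Hp Hq; rewrite (addrCA (e *: b)) /d.
set u := f _; set t := f _; set s := f _; set r := f _.
set p' := 'D_b _ (x *: a + _); set q' := 'D_a _ (x' *: a + _).
set p := 'D_b _ z; set q := 'D_a _ z.
move: u t s r p q p' q' => u t s r p q p' q' Ep Eq Hp Hq.
(* both equal the second difference divided by e ^+ 2 *)
have E : p' = q'.
  by apply: (mulIf (expf_neq0 2 (lt0r_neq0 e0))); rewrite -Ep -Eq; ring.
have := ler_distD p' p q; rewrite {2}E (distrC q').
by move: Hp Hq; lra.
Qed.

End MixedPartials.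

(** * Partial derivatives and smoothness on open subsets of C^n *)
(** Without derivability both sides are 0, the default value of a limit that
    does not exist.  Hence signs can be moved through [pd] and [pdbar] with no
    smoothness assumption. *)
Lemma deriveN_total (R : realType) (V : normedModType R) (f : V -> R) (v z : V) :
  'D_v (- f) z = - 'D_v f z.
Proof.
have [df|ndf] := pselect (derivable f z v); first exact: deriveN.
have ndNf : ~ derivable (- f) z v by move=> /derivableN; rewrite opprK.
have nd0 (h : V -> R) : ~ derivable h z v -> 'D_v h z = 0.
  move=> ndh; exact: (dvgP ndh).
by rewrite !nd0 // oppr0.
Qed.

Section RealPartials.
Local Open Scope classical_set_scope.
Variables (R : realType) (n : nat).
Implicit Types (F G : 'rV[R]_(n + n) -> R[i]) (U : set 'rV[R]_(n + n)).
Implicit Types (z w : 'rV[R]_(n + n)) (m : 'I_(n + n)) (c d : R[i]).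

(** The values of [rpartial] are derivatives, and not the default value of a
    limit that does not exist. *)
Definition has_partials F z : Prop :=
  forall m, is_cderive z (delta_mx 0 m) F (rpartial m F z).

Lemma rpartialE m F z d : is_cderive z (delta_mx 0 m) F d -> rpartial m F z = d.
Proof.
case=> F1 F2; case: d F1 F2 => d1 d2 /= F1 F2.
by rewrite /rpartial /re_part /im_part (@derive_val _ _ _ _ _ _ _ F1)
  (@derive_val _ _ _ _ _ _ _ F2).
Qed.

Lemma has_partialsP F z :
  (forall m, exists d, is_cderive z (delta_mx 0 m) F d) -> has_partials F z.
Proof. by move=> D m; have [d Fd] := D m; rewrite (rpartialE Fd). Qed.

Lemma has_partials_lin c F G z : has_partials F z -> has_partials G z ->
  has_partials (fun w => c * F w + G w) z.
Proof.
by move=> DF DG; apply: has_partialsP => m; eexists; apply: is_cderive_lin.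
Qed.

Lemma has_partials_mul F G z : has_partials F z -> has_partials G z ->
  has_partials (fun w => F w * G w) z.
Proof.
by move=> DF DG; apply: has_partialsP => m; eexists; apply: is_cderive_mul.
Qed.

Lemma has_partials_cexp F z : has_partials F z ->
  has_partials (fun w => cexp (F w)) z.
Proof.
by move=> DF; apply: has_partialsP => m; eexists; apply: is_cderive_cexp.
Qed.

Lemma Cdiff_has_partials r U F z : Cdiff r.+1 U F -> U z -> has_partials F z.
Proof.
move=> [_ D] Uz m; have [/(_ z Uz) [D1 D2] _] := D m.
by split; [exact: (derivableP D1)|exact: (derivableP D2)].
Qed.

Lemma Cdiff_continuous r U F z : Cdiff r U F -> U z ->
  {for z, continuous (re_part F)} /\ {for z, continuous (im_part F)}.
Proof. by case: r => [|r] [DF _]; exact: DF. Qed.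

Lemma near_eq_rpartial m F G z : {near z, F =1 G} -> rpartial m F z = rpartial m G z.
Proof.
move=> FG; rewrite /rpartial; congr Complex; apply: near_eq_derive;
  by apply: filterS FG => w FGw; rewrite /re_part /im_part FGw.
Qed.

Lemma eq_open_near U F G z : open U -> U z -> (forall w, U w -> F w = G w) ->
  {near z, F =1 G}.
Proof.
by move=> oU Uz FG; apply: filterS (open_nbhs_nbhs (conj oU Uz)) => w; exact: FG.
Qed.

Lemma near_eq_continuous (f g : 'rV[R]_(n + n) -> R) z : {near z, f =1 g} ->
  {for z, continuous f} -> {for z, continuous g}.
Proof.
move=> fg; rewrite /prop_for /continuous_at (nbhs_singleton fg) => fz.
exact: cvg_trans (near_eq_cvg fg) fz.
Qed.

Lemma Cdiff_congr r U F G : open U -> (forall z, U z -> F z = G z) ->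
  Cdiff r U F -> Cdiff r U G.
Proof.
move=> oU; elim: r F G => [|r IH] F G FG [CF DF]; split.
1,3: move=> z Uz; have [C1 C2] := CF z Uz; have FGz := eq_open_near oU Uz FG;
     split; [apply: near_eq_continuous C1|apply: near_eq_continuous C2];
     by apply: filterS FGz => w FGw; rewrite /re_part /im_part FGw.
by [].
move=> m; have [D1 D2] := DF m; split.
  move=> z Uz; have [E1 E2] := D1 z Uz; have FGz := eq_open_near oU Uz FG.
  split; [move: E1|move: E2]; apply: near_eq_derivable;
    by apply: filterS FGz => w FGw; rewrite /re_part /im_part FGw.
apply: IH D2 => z Uz; apply: near_eq_rpartial; exact: eq_open_near FG.
Qed.

Lemma continuous_scale (f : 'rV[R]_(n + n) -> R) (a : R) z :
  {for z, continuous f} -> {for z, continuous (a *: f)}.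
Proof. by move=> fz; exact: (@continuousZl_tmp R R _ f a z fz). Qed.

(** One statement for sums and scalar multiples: the partial derivatives are
    combined in the same way, which makes the induction on [r] immediate. *)
Lemma Cdiff_lin r U c F G : open U -> Cdiff r U F -> Cdiff r U G ->
  Cdiff r U (fun z => c * F z + G z).
Proof.
move=> oU; elim: r F G => [|r IH] F G DF DG; split.
1,3: move=> z Uz; have [F1 F2] := DF.1 z Uz; have [G1 G2] := DG.1 z Uz; split.
1,3: rewrite (_ : re_part _ = complex.Re c *: re_part F - complex.Im c *: im_part F
                            + re_part G);
     [exact: (continuousD (continuousB (continuous_scale F1) (continuous_scale F2)) G1)
     |by apply/funext => w; rewrite /re_part /= Re_add Re_mul].
1,2: rewrite (_ : im_part _ = complex.Re c *: im_part F + complex.Im c *: re_part F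
                            + im_part G);
     [exact: (continuousD (continuousD (continuous_scale F2) (continuous_scale F1)) G2)
     |by apply/funext => w; rewrite /im_part /= Im_add Im_mul].
by [].
have HF z Uz := @Cdiff_has_partials _ _ F z DF Uz.
have HG z Uz := @Cdiff_has_partials _ _ G z DG Uz.
move=> m; split.
  move=> z Uz; have [D1 D2] := has_partials_lin c (HF z Uz) (HG z Uz) m.
  by split; [exact: (@ex_derive _ _ _ _ _ _ _ D1)|exact: (@ex_derive _ _ _ _ _ _ _ D2)].
apply: (Cdiff_congr oU) (IH _ _ (DF.2 m).2 (DG.2 m).2) => z Uz.
by rewrite (rpartialE (is_cderive_lin c (HF z Uz m) (HG z Uz m))).
Qed.

Lemma Cdiff_cst r U c : Cdiff r U (fun=> c).
Proof.
elim: r c => [|r IH] c; split.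
1,3: by move=> z _; split; exact: (@cst_continuous _ _ _ z).
by [].
move=> m; split.
  by move=> z _; split; exact: (@derivable_cst _ _ _ _ z).
rewrite (_ : rpartial _ _ = fun=> 0); first exact: IH.
apply/funext => z; apply: rpartialE; split; exact: is_derive_cst.
Qed.

Lemma re_rpartial m F :
  re_part (rpartial m F) = 'D_(delta_mx 0 m) (re_part F).
Proof. by []. Qed.

Lemma im_rpartial m F :
  im_part (rpartial m F) = 'D_(delta_mx 0 m) (im_part F).
Proof. by []. Qed.

Lemma rpartial_eq m m' F G z :
  'D_(delta_mx 0 m) (re_part F) z = 'D_(delta_mx 0 m') (re_part G) z ->
  'D_(delta_mx 0 m) (im_part F) z = 'D_(delta_mx 0 m') (im_part G) z ->
  rpartial m F z = rpartial m' G z.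
Proof. by rewrite /rpartial => -> ->. Qed.

Lemma rpartial_comm r U F m m' z : open U -> Cdiff r.+2 U F -> U z ->
  rpartial m (rpartial m' F) z = rpartial m' (rpartial m F) z.
Proof.
move=> oU DF Uz.
have DG m0 m1 w : U w ->
    derivable ('D_(delta_mx 0 m0) (re_part F)) w (delta_mx 0 m1) /\
    derivable ('D_(delta_mx 0 m0) (im_part F)) w (delta_mx 0 m1).
  move=> Uw; have := ((DF.2 m0).2.2 m1).1 w Uw.
  by rewrite re_rpartial im_rpartial.
have CG m0 m1 :
    {for z, continuous ('D_(delta_mx 0 m1) ('D_(delta_mx 0 m0) (re_part F)))} /\
    {for z, continuous ('D_(delta_mx 0 m1) ('D_(delta_mx 0 m0) (im_part F)))}.
  have := Cdiff_continuous ((DF.2 m0).2.2 m1).2 Uz.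
  by rewrite !re_rpartial !im_rpartial.
have DU m0 w (Uw : U w) := (DF.2 m0).1 w Uw.
have Ere := mixed_partials oU Uz (fun w Uw => conj (DU m' w Uw).1 (DU m w Uw).1)
  (fun w Uw => conj (DG m' m w Uw).1 (DG m m' w Uw).1) (CG m' m).1 (CG m m').1.
have Eim := mixed_partials oU Uz (fun w Uw => conj (DU m' w Uw).2 (DU m w Uw).2)
  (fun w Uw => conj (DG m' m w Uw).2 (DG m m' w Uw).2) (CG m' m).2 (CG m m').2.
apply: rpartial_eq.
  by rewrite !re_rpartial; exact: Ere.
by rewrite !im_rpartial; exact: Eim.
Qed.

End RealPartials.

(** * Calculus of local functions modulo equality on the charts *)
Section LocalFunctions.
Variables (R : realType) (n : nat) (M : complex_manifold R n).
Implicit Types (h k : lfun M) (K L : 'I_n + 'I_n) (c : R[i]).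

Lemma lfD h k a z : (h + k) a z = h a z + k a z. Proof. by []. Qed.
Lemma lfN h a z : (- h) a z = - h a z. Proof. by []. Qed.
Lemma lfM h k a z : (h * k) a z = h a z * k a z. Proof. by []. Qed.
Lemma lfZ c h a z : (c *: h) a z = c * h a z. Proof. by []. Qed.
Lemma lf0 a z : (0 : lfun M) a z = 0. Proof. by []. Qed.
Lemma lf_sum (I : Type) (r : seq I) (P : pred I) (F : I -> lfun M) a z :
  (\sum_(i <- r | P i) F i) a z = \sum_(i <- r | P i) F i a z.
Proof. by rewrite !fct_sumE. Qed.
Definition lfE := (lfD, lfN, lfM, lfZ, lf0, lf_sum).

Lemma eqM_sym h k : eqM h k -> eqM k h.
Proof. by move=> E a z az; rewrite E. Qed.
Lemma eqM_trans h k l : eqM h k -> eqM k l -> eqM h l.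
Proof. by move=> E E' a z az; rewrite E // E'. Qed.

(** The hypothesis under which the rules of calculus hold for [pdC]. *)
Definition diffableM h : Prop := forall a z, cod a z -> has_partials (h a) z.

Lemma smoothM_diffableM h : smoothM h -> diffableM h.
Proof. by move=> sh a z az; exact: Cdiff_has_partials (sh a 1) az. Qed.

Lemma diffableM_lin c h k : diffableM h -> diffableM k -> diffableM (c *: h + k).
Proof. by move=> dh dk a z az; apply: has_partials_lin; [exact: dh|exact: dk]. Qed.

Lemma diffableM_mul h k : diffableM h -> diffableM k -> diffableM (h * k).
Proof. by move=> dh dk a z az; apply: has_partials_mul; [exact: dh|exact: dk]. Qed.

Lemma diffableM_density h : diffableM h -> diffableM (density h).
Proof. by move=> dh a z az; apply: has_partials_cexp; exact: dh. Qed.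

(** [pd] and [pdbar] differ only by the sign of the imaginary unit, so that
    the rules for both are proved at once for [pdC]. *)
Definition wirtinger K : R[i] := if K is inl _ then - 'i%C else 'i%C.
Definition cindex K : 'I_n := match K with inl i => i | inr j => j end.

Lemma pdCE K h a z : pdC K h a z =
  2^-1 * (rpartial (lshift n (cindex K)) (h a) z +
          wirtinger K * rpartial (rshift n (cindex K)) (h a) z).
Proof. by case: K => i /=; rewrite /pd /pdbar /dz /dzbar ?mulNr. Qed.

Lemma pdC_congr K h k : eqM h k -> eqM (pdC K h) (pdC K k).
Proof.
move=> E a z az; have N := eq_open_near (@cod_open _ _ M a) az (E a).
by rewrite !pdCE !(near_eq_rpartial _ N).
Qed.

Lemma pdC_lin K c h k a z : diffableM h -> diffableM k -> cod a z ->
  pdC K (c *: h + k) a z = c * pdC K h a z + pdC K k a z.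
Proof.
move=> dh dk az; rewrite !pdCE.
rewrite !(rpartialE (is_cderive_lin c (dh a z az _) (dk a z az _))).
move: (rpartial _ (h a) z) (rpartial _ (h a) z) (rpartial _ (k a) z) (rpartial _ (k a) z).
by move=> p q r s; ring.
Qed.

Lemma pdC_mul K h k a z : diffableM h -> diffableM k -> cod a z ->
  pdC K (h * k) a z = pdC K h a z * k a z + h a z * pdC K k a z.
Proof.
move=> dh dk az; rewrite !pdCE.
rewrite !(rpartialE (is_cderive_mul (dh a z az _) (dk a z az _))).
move: (rpartial _ (h a) z) (rpartial _ (h a) z) (rpartial _ (k a) z) (rpartial _ (k a) z).
by move=> p q r s; ring.
Qed.

Lemma pdC_density K h a z : diffableM h -> cod a z ->
  pdC K (density h) a z = density h a z * pdC K h a z.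
Proof.
move=> dh az; rewrite !pdCE.
rewrite !(rpartialE (is_cderive_cexp (dh a z az _))) /density.
move: (rpartial _ (h a) z) (rpartial _ (h a) z) => p q; ring.
Qed.

Lemma pdC0 K : pdC K (0 : lfun M) = 0.
Proof.
apply/funext => a; apply/funext => z; rewrite pdCE.
have E m : rpartial m ((0 : lfun M) a) z = 0.
  by apply: rpartialE; split; exact: is_derive_cst.
by rewrite !E mulr0 addr0 mulr0.
Qed.

Lemma pdCN K h : pdC K (- h) = - pdC K h.
Proof.
apply/funext => a; apply/funext => z; rewrite lfN !pdCE.
have E m : rpartial m ((- h) a) z = - rpartial m (h a) z.
  rewrite /rpartial (_ : re_part ((- h) a) = - re_part (h a)).
    rewrite (_ : im_part ((- h) a) = - im_part (h a)).
      by rewrite !deriveN_total.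
    by apply/funext => w; change (complex.Im (- h a w) = - complex.Im (h a w)); case: (h a w).
  by apply/funext => w; change (complex.Re (- h a w) = - complex.Re (h a w)); case: (h a w).
rewrite !E; move: (rpartial _ _ _) (rpartial _ _ _) => p q; ring.
Qed.

Lemma smoothM_congr h k : eqM h k -> smoothM h -> smoothM k.
Proof.
by move=> E sh a r; apply: Cdiff_congr (sh a r); [exact: cod_open|exact: E].
Qed.

Lemma smoothM_lin c h k : smoothM h -> smoothM k -> smoothM (c *: h + k).
Proof. by move=> sh sk a r; apply: Cdiff_lin; [exact: cod_open|exact: sh|exact: sk]. Qed.

Lemma smoothM_cst c : smoothM ((fun _ _ => c) : lfun M).
Proof. by move=> a r; exact: Cdiff_cst. Qed.

Lemma smoothM0 : smoothM (0 : lfun M). Proof. exact: smoothM_cst. Qed.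

Lemma smoothMZ c h : smoothM h -> smoothM (c *: h).
Proof. by move=> sh; rewrite -[_ *: _]addr0; apply: smoothM_lin => //; exact: smoothM0. Qed.

Lemma pdCZ K c h a z : diffableM h -> cod a z ->
  pdC K (c *: h) a z = c * pdC K h a z.
Proof.
move=> dh az; rewrite -[c *: h]addr0 pdC_lin ?pdC0 ?lf0 ?addr0 //.
exact/smoothM_diffableM/smoothM0.
Qed.

Lemma pdCD K h k a z : diffableM h -> diffableM k -> cod a z ->
  pdC K (h + k) a z = pdC K h a z + pdC K k a z.
Proof. by move=> dh dk az; have := pdC_lin K 1 dh dk az; rewrite scale1r mul1r. Qed.

Lemma smoothM_rpartial h m : smoothM h -> smoothM ((fun a => rpartial m (h a)) : lfun M).
Proof. by move=> sh a r; exact: ((sh a r.+1).2 m).2. Qed.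

Lemma smoothM_pdC K h : smoothM h -> smoothM (pdC K h).
Proof.
move=> sh.
have := smoothMZ 2^-1 (smoothM_lin (wirtinger K)
  (smoothM_rpartial (rshift n (cindex K)) sh) (smoothM_rpartial (lshift n (cindex K)) sh)).
by apply: smoothM_congr => a z _; rewrite pdCE addrC.
Qed.

(** The Wirtinger derivatives are combinations with constant coefficients of
    real partial derivatives, and the latter commute. *)
Lemma pdC_comm K L h : smoothM h -> eqM (pdC K (pdC L h)) (pdC L (pdC K h)).
Proof.
have rpartial_pdC m H a z : smoothM h -> cod a z ->
    rpartial m (pdC H h a) z =
    2^-1 * (rpartial m (rpartial (lshift n (cindex H)) (h a)) z +
          wirtinger H * rpartial m (rpartial (rshift n (cindex H)) (h a)) z).
  move=> sh az.
  have D m' : has_partials (rpartial m' (h a)) z.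
    exact: (smoothM_diffableM (smoothM_rpartial m' sh) az).
  have Z : has_partials ((0 : lfun M) a) z by exact: (smoothM_diffableM smoothM0 az).
  have E := is_cderive_lin 2^-1 (is_cderive_lin (wirtinger H)
     (D (rshift n (cindex H)) m) (D (lshift n (cindex H)) m)) (Z m).
  have E0 : rpartial m ((0 : lfun M) a) z = 0.
    by apply: rpartialE; split; exact: is_derive_cst.
  have -> : pdC H h a = fun w => 2^-1 * (wirtinger H *
      rpartial (rshift n (cindex H)) (h a) w + rpartial (lshift n (cindex H)) (h a) w)
      + (0 : lfun M) a w.
    by apply/funext => w; rewrite pdCE lf0 addr0 [in RHS]addrC.
  by rewrite (rpartialE E) E0 addr0 addrC.
move=> sh a z az; rewrite (pdCE K) (pdCE L).
rewrite !(rpartial_pdC _ _ _ _ sh az).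
have C m m' : rpartial m (rpartial m' (h a)) z = rpartial m' (rpartial m (h a)) z.
  exact: rpartial_comm (@cod_open _ _ M a) (sh a 2) az.
rewrite (C (lshift n (cindex K)) (lshift n (cindex L))).
rewrite (C (lshift n (cindex K)) (rshift n (cindex L))).
rewrite (C (rshift n (cindex K)) (lshift n (cindex L))).
rewrite (C (rshift n (cindex K)) (rshift n (cindex L))).
move: (rpartial _ _ _) (rpartial _ _ _) (rpartial _ _ _) (rpartial _ _ _).
by move=> p q r s; ring.
Qed.

Implicit Types A B : 'I_n -> lfun M.

Lemma hol_vf_congr A B : (forall i, eqM (A i) (B i)) -> hol_vf A -> hol_vf B.
Proof.
move=> E [[sA tA] hA]; split; [split|].
- by move=> i; apply: smoothM_congr (E i) (sA i).
- move=> a b p i ap bp; rewrite -(E i b _ (coord_cod bp)) (tA a b p i ap bp).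
  by apply: eq_bigr => k _; rewrite (E k a _ (coord_cod ap)).
- by move=> i k; apply: eqM_trans (hA i k); exact/(pdC_congr (inr k))/eqM_sym.
Qed.

Lemma antihol_vf_congr A B :
  (forall i, eqM (A i) (B i)) -> antihol_vf A -> antihol_vf B.
Proof.
move=> E [[sA tA] hA]; split; [split|].
- by move=> i; apply: smoothM_congr (E i) (sA i).
- move=> a b p i ap bp; rewrite -(E i b _ (coord_cod bp)) (tA a b p i ap bp).
  by apply: eq_bigr => k _; rewrite (E k a _ (coord_cod ap)).
- by move=> i k; apply: eqM_trans (hA i k); exact/(pdC_congr (inl k))/eqM_sym.
Qed.

Lemma hol_vfZ c A : hol_vf A -> hol_vf (fun i => c *: A i).
Proof.
move=> [[sA tA] hA]; split; [split|].
- by move=> i; apply: smoothMZ.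
- move=> a b p i ap bp; rewrite lfZ (tA a b p i ap bp) mulr_sumr.
  by apply: eq_bigr => k _; rewrite lfZ mulrCA.
- move=> i k a z az; have := pdCZ (inr k) c (smoothM_diffableM (sA i)) az.
  by rewrite [pdC _ (A i) a z](hA i k a z az) lf0 mulr0.
Qed.

Lemma antihol_vfZ c A : antihol_vf A -> antihol_vf (fun i => c *: A i).
Proof.
move=> [[sA tA] hA]; split; [split|].
- by move=> i; apply: smoothMZ.
- move=> a b p i ap bp; rewrite lfZ (tA a b p i ap bp) mulr_sumr.
  by apply: eq_bigr => k _; rewrite lfZ mulrCA.
- move=> i k a z az; have := pdCZ (inl k) c (smoothM_diffableM (sA i)) az.
  by rewrite [pdC _ (A i) a z](hA i k a z az) lf0 mulr0.
Qed.

End LocalFunctions.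

(** * The product of the completed tensor product, row by row *)
Section ChiralProduct.
Variables (n : nat) (V : zmodType) (mul : V -> V -> V) (d : 'I_n -> V -> V).
Implicit Types (x y : slot n -> V) (s : slot n).

Lemma chprod_eq0 x y s :
  (forall p q, (sdeg p + sdeg q)%N = sdeg s ->
     [/\ mul (x p) (y q) = 0, forall i, mul (x p) (d i (y q)) = 0
       & forall i, mul (d i (x p)) (y q) = 0]) ->
  chprod mul d x y s = 0.
Proof.
move=> H.
have H0 p q : (sdeg p + sdeg q)%N = sdeg s -> mul (x p) (y q) = 0.
  by move=> e; have [] := H p q e.
have H1 p q i : (sdeg p + sdeg q)%N = sdeg s -> mul (x p) (d i (y q)) = 0.
  by move=> e; have [] := H p q e.
have H2 p q i : (sdeg p + sdeg q)%N = sdeg s -> mul (d i (x p)) (y q) = 0.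
  by move=> e; have [] := H p q e.
case: s {H} H0 H1 H2 => [|k||k||] H0 H1 H2 /=;
  repeat (rewrite big1; last by move=> i _; rewrite ?H1 ?H2 ?subrr);
  by rewrite !H0 ?subr0 ?addr0.
Qed.

(** Used first for [eqM] on coefficients, then for slotwise [eqM] on rows. *)
Lemma chprod_compat (E : V -> V -> Prop) x x' y y' :
  (forall u u' w w', E u u' -> E w w' -> E (u + w) (u' + w')) ->
  (forall u u', E u u' -> E (- u) (- u')) -> E 0 0 ->
  (forall u u' w w', E u u' -> E w w' -> E (mul u w) (mul u' w')) ->
  (forall i u u', E u u' -> E (d i u) (d i u')) ->
  (forall s, E (x s) (x' s)) -> (forall s, E (y s) (y' s)) ->
  forall s, E (chprod mul d x y s) (chprod mul d x' y' s).
Proof.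
move=> ED EN E0 EM Ed Ex Ey.
have ES (F G : 'I_n -> V) : (forall i, E (F i) (G i)) ->
    E (\sum_i F i) (\sum_i G i).
  by move=> EFG; elim/big_rec2: _ => // i u w _; exact: ED.
by case=> [|k||k||] /=; repeat first [exact: Ex | exact: Ey | apply EM | apply Ed
  | apply EN | apply ED | (apply: ES => ?)].
Qed.

(** When the first factor is modified according to the degree [q] of the
    second one, summing over [q] amounts to using in each term of the product
    the degree of the component of [y] occurring in it. *)
Lemma chprod_graded (mul0 : forall u, mul u 0 = 0) (d0 : forall i, d i 0 = 0)
    (K : nat -> V -> V) x y s :
  \sum_(q < 4) chprod mul d (fun a => K q (x a))
                 (fun a => if sdeg a == q then y a else 0) s =
  match s with
  | su => mul (K 0%N (x su)) (y su)
  | sA k => mul (K 1%N (x su)) (y (sA k)) + mul (K 0%N (x (sA k))) (y su)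
  | st => mul (K 1%N (x su)) (y st) + mul (K 0%N (x st)) (y su)
  | sA2 k =>
      mul (K 2%N (x su)) (y (sA2 k)) + mul (K 0%N (x (sA2 k))) (y su)
      - \sum_(i < n) (mul (K 1%N (x (sA i))) (d i (y (sA k)))
                      - mul (d i (K 1%N (x (sA k)))) (y (sA i)))
      - mul (K 1%N (x st)) (y (sA k)) + mul (K 1%N (x (sA k))) (y st)
  | st2 => mul (K 2%N (x su)) (y st2) + mul (K 0%N (x st2)) (y su)
  | su2 =>
      mul (K 3%N (x su)) (y su2) + mul (K 0%N (x su2)) (y su)
      - \sum_(i < n) mul (K 2%N (x (sA i))) (d i (y st2))
      - \sum_(i < n) mul (d i (K 1%N (x st2))) (y (sA i))
      - mul (K 2%N (x st)) (y st2) - mul (K 1%N (x st2)) (y st)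
  end.
Proof.
have Z1 k q : \sum_(i < n) (mul (K q (x (sA i))) (d i 0)
    - mul (d i (K q (x (sA k)))) 0) = 0.
  by apply: big1 => i _; rewrite d0 !mul0 subrr.
have Z2 q : \sum_(i < n) mul (K q (x (sA i))) (d i 0) = 0.
  by apply: big1 => i _; rewrite d0 mul0.
have Z3 q : \sum_(i < n) mul (d i (K q (x st2))) 0 = 0.
  by apply: big1 => i _; rewrite mul0.
rewrite !big_ord_recl big_ord0 /=.
(* the indices 1, 2 and 3 of the sum appear as iterated bumps *)
have [B1 B2 B3] : [/\ bump 0 0 = 1, bump 0 1 = 2 & bump 0 2 = 3]%N by [].
case: s => [|k||k||] /=; rewrite !mul0 ?Z1 ?Z2 ?Z3 ?oppr0 ?(add0r, addr0)
  ?B1 ?B2 ?B3 //; try by rewrite addrC.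
- by rewrite (addrC _ (mul (K 2%N _) _)) addrCA !addrA.
- move: (\sum_i _) (\sum_i _) => S T.
  move: (mul _ _) (mul _ _) (mul _ _) (mul _ _) => A P Q W.
  rewrite !addrA (addrC _ W) (addrC _ A) !addrA (addrC A W) (addrAC _ (- Q) (- S)).
  by rewrite (addrAC _ (- T) (- S)) (addrAC _ (- Q) (- P)).
Qed.

End ChiralProduct.

Section TensorProduct.
Variables (R : realType) (n : nat) (M : complex_manifold R n).
Implicit Types (x y : bfam M) (u w : slot n -> lfun M) (h : lfun M).

Lemma pd0 i : pd i (0 : lfun M) = 0. Proof. exact: (pdC0 M (inl i)). Qed.
Lemma pdbar0 i : pdbar i (0 : lfun M) = 0. Proof. exact: (pdC0 M (inr i)). Qed.

(** The product of the antiholomorphic complex with smooth coefficients; it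
    multiplies two rows of a tensor family. *)
Definition cmul u w : slot n -> lfun M :=
  chprod (fun h1 h2 : lfun M => h1 * h2) (@pdbar R n M) u w.
(** The holomorphic derivative appearing in the product, acting on a row. *)
Definition pdrow i u : slot n -> lfun M := fun b => pd i (u b).
(** The sign for moving a holomorphic factor of degree [q] past the
    antiholomorphic factor in which the row lives. *)
Definition koszul (q : nat) u : slot n -> lfun M :=
  fun b => (-1) ^+ (sdeg b * q) *: u b.

Lemma koszulE q u b :
  koszul q u b = if odd (sdeg b) && odd q then - u b else u b.
Proof.
rewrite /koszul -signr_odd oddM; case: (_ && _); first by rewrite expr1 scaleN1r.
by rewrite expr0 scale1r.
Qed.

Lemma koszul_even q u : ~~ odd q -> koszul q u = u.
Proof.
move=> q0; apply/funext => b.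
by rewrite koszulE (negbTE q0) andbF.
Qed.

Lemma cmul0l w : cmul 0 w = 0.
Proof.
apply/funext => b; apply: chprod_eq0 => p q _.
by split=> [|i|i]; rewrite ?pdbar0 mul0r.
Qed.

Lemma cmul0r u : cmul u 0 = 0.
Proof.
apply/funext => b; apply: chprod_eq0 => p q _.
by split=> [|i|i]; rewrite ?pdbar0 mulr0.
Qed.

Lemma pdrow0 i : pdrow i 0 = 0.
Proof. by apply/funext => b; rewrite /pdrow pd0. Qed.

Lemma rows_sum m (F : 'I_m -> slot n -> lfun M) b :
  (\sum_i F i) b = \sum_i F i b.
Proof. by rewrite (big_morph (fun u : slot n -> lfun M => u b) (id1 := 0) (op1 := +%R)). Qed.

Lemma bprod_sum x y s b : bprod x y s b = (\sum_(q < 4) chprod cmul pdrow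
  (fun a => koszul q (x a)) (fun a => if sdeg a == q then y a else 0) s) b.
Proof.
rewrite /bprod (big_morph (fun F : bfam M => F s b) (id1 := 0) (op1 := +%R)) //.
rewrite rows_sum; apply: eq_bigr => q _.
congr (chprod _ _ _ _ _ _); apply/funext => a; apply/funext => c.
by case: ifP.
Qed.

(** The Koszul sign only depends on the holomorphic degree of the second
    factor, which is determined by the term of the product. *)
Lemma bprodE x y s b : bprod x y s b = match s with
  | su => cmul (koszul 0 (x su)) (y su) b
  | sA k => cmul (koszul 1 (x su)) (y (sA k)) b + cmul (koszul 0 (x (sA k))) (y su) b
  | st => cmul (koszul 1 (x su)) (y st) b + cmul (koszul 0 (x st)) (y su) b
  | sA2 k =>
      cmul (koszul 2 (x su)) (y (sA2 k)) b + cmul (koszul 0 (x (sA2 k))) (y su) b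
      - \sum_(i < n) (cmul (koszul 1 (x (sA i))) (pdrow i (y (sA k))) b
                      - cmul (pdrow i (koszul 1 (x (sA k)))) (y (sA i)) b)
      - cmul (koszul 1 (x st)) (y (sA k)) b + cmul (koszul 1 (x (sA k))) (y st) b
  | st2 => cmul (koszul 2 (x su)) (y st2) b + cmul (koszul 0 (x st2)) (y su) b
  | su2 =>
      cmul (koszul 3 (x su)) (y su2) b + cmul (koszul 0 (x su2)) (y su) b
      - \sum_(i < n) cmul (koszul 2 (x (sA i))) (pdrow i (y st2)) b
      - \sum_(i < n) cmul (pdrow i (koszul 1 (x st2))) (y (sA i)) b
      - cmul (koszul 2 (x st)) (y st2) b - cmul (koszul 1 (x st2)) (y st) b
  end.
Proof.
rewrite bprod_sum (chprod_graded cmul0r pdrow0).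
have rD (u w : slot n -> lfun M) : (u + w) b = u b + w b by [].
have rN (u : slot n -> lfun M) : (- u) b = - u b by [].
by case: s => [|k||k||] //; rewrite ?(rD, rN) ?rows_sum.
Qed.

Ltac simpl_arow :=
  repeat (rewrite big1; last by move=> ? _; rewrite ?(pdbar0, mul0r, mulr0, subr0));
  rewrite ?(pdbar0, mul0r, mulr0, addr0, add0r, oppr0, subr0, sub0r) //.

Implicit Type A : 'I_n -> lfun M.

Lemma koszulF :
  koszul = fun q u b => if odd (sdeg b) && odd q then - u b else u b.
Proof. by apply/funext => q; apply/funext => u; apply/funext => b; exact: koszulE. Qed.

(** The rows that are homogeneous of degree 0, 1, 2 and 3. *)
Definition arow0 h : slot n -> lfun M := fun b => if b is su then h else 0.
Definition arow1 A h : slot n -> lfun M := fun b =>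
  match b with sA j => A j | st => h | _ => 0 end.
Definition arow2 A h : slot n -> lfun M := fun b =>
  match b with sA2 j => A j | st2 => h | _ => 0 end.
Definition arow3 h : slot n -> lfun M := fun b => if b is su2 then h else 0.

Lemma koszul_arow0 q h : koszul q (arow0 h) = arow0 h.
Proof. by rewrite koszulF; apply/funext => -[|j||j||] /=; rewrite ?oppr0 ?if_same. Qed.

Lemma koszul_arow1 q A h : odd q -> koszul q (arow1 A h) = arow1 (- A) (- h).
Proof. by move=> oq; rewrite koszulF; apply/funext => -[|j||j||] /=; rewrite ?oq ?oppr0. Qed.

Lemma koszul_arow2 q A h : koszul q (arow2 A h) = arow2 A h.
Proof. by rewrite koszulF; apply/funext => -[|j||j||] /=; rewrite ?oppr0 ?if_same. Qed.

Lemma pdrow_arow0 i h : pdrow i (arow0 h) = arow0 (pd i h).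
Proof. by apply/funext => -[|j||j||]; rewrite /pdrow /= ?pd0. Qed.

Lemma pdrow_arow1 i A h : pdrow i (arow1 A h) = arow1 (fun j => pd i (A j)) (pd i h).
Proof. by apply/funext => -[|j||j||]; rewrite /pdrow /= ?pd0. Qed.

Lemma cmul_arow00 h h' : cmul (arow0 h) (arow0 h') = arow0 (h * h').
Proof. apply/funext => b; rewrite /cmul; case: b => [|l||l||] /=; simpl_arow. Qed.

Lemma cmul_arow01 h A' h' : cmul (arow0 h) (arow1 A' h') = arow1 (fun j => h * A' j) (h * h').
Proof. apply/funext => b; rewrite /cmul; case: b => [|l||l||] /=; simpl_arow. Qed.

Lemma cmul_arow10 A h h' : cmul (arow1 A h) (arow0 h') = arow1 (fun j => A j * h') (h * h').
Proof. apply/funext => b; rewrite /cmul; case: b => [|l||l||] /=; simpl_arow. Qed.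

Lemma cmul_arow02 h A' h' : cmul (arow0 h) (arow2 A' h') = arow2 (fun j => h * A' j) (h * h').
Proof. apply/funext => b; rewrite /cmul; case: b => [|l||l||] /=; simpl_arow. Qed.

Lemma cmul_arow20 A h h' : cmul (arow2 A h) (arow0 h') = arow2 (fun j => A j * h') (h * h').
Proof. apply/funext => b; rewrite /cmul; case: b => [|l||l||] /=; simpl_arow. Qed.

Lemma cmul_arow11 A h A' h' : cmul (arow1 A h) (arow1 A' h') =
  arow2 (fun l => - \sum_(j < n) (A j * pdbar j (A' l) - pdbar j (A l) * A' j)
                 - h * A' l + A l * h') 0.
Proof. apply/funext => b; rewrite /cmul; case: b => [|l||l||] /=; simpl_arow. Qed.

Lemma cmul_arow12 A h A' h' : cmul (arow1 A h) (arow2 A' h') =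
  arow3 (- \sum_(j < n) A j * pdbar j h' - h * h').
Proof.
apply/funext => b; rewrite /cmul; case: b => [|l||l||] /=; try simpl_arow.
by rewrite [X in _ - X - _]big1 ?subr0 // => j _; rewrite mulr0.
Qed.

Lemma cmul_arow21 A h A' h' : cmul (arow2 A h) (arow1 A' h') =
  arow3 (- \sum_(j < n) pdbar j h * A' j - h * h').
Proof.
apply/funext => b; rewrite /cmul; case: b => [|l||l||] /=; simpl_arow.
Qed.

Lemma cmul_arow22 A h A' h' : cmul (arow2 A h) (arow2 A' h') = 0.
Proof. apply/funext => b; rewrite /cmul; case: b => [|l||l||] /=; simpl_arow. Qed.

End TensorProduct.

(** * The product of Psi with itself *)
Section Psi.
Variables (R : realType) (n : nat) (M : complex_manifold R n).
Variables (g : 'I_n -> 'I_n -> lfun M) (vbar v : 'I_n -> lfun M).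
Variables (phi phibar : lfun M).
Local Notation Psi := (mkPsi g vbar v phi phibar).

(** Every row of [Psi] is homogeneous; its degree is 2 minus the degree of the
    holomorphic slot. *)
Lemma Psi_su : Psi su = arow2 vbar phibar.
Proof. by apply/funext => -[]. Qed.
Lemma Psi_sA k : Psi (sA k) = arow1 (g k) (v k).
Proof. by apply/funext => -[]. Qed.
Lemma Psi_st : Psi st = arow1 (- vbar) 0.
Proof. by apply/funext => -[]. Qed.
Lemma Psi_sA2 k : Psi (sA2 k) = arow0 (v k).
Proof. by apply/funext => -[]. Qed.
Lemma Psi_st2 : Psi st2 = arow0 phi.
Proof. by apply/funext => -[]. Qed.
Lemma Psi_su2 : Psi su2 = 0.
Proof. by apply/funext => -[]. Qed.
Definition PsiE := (Psi_su, Psi_sA, Psi_st, Psi_sA2, Psi_st2, Psi_su2).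

Lemma lfP (h1 h2 : lfun M) : (forall a z, h1 a z = h2 a z) -> h1 = h2.
Proof. by move=> E; apply/funext => a; apply/funext => z. Qed.

Lemma koszul0 q : koszul q (0 : slot n -> lfun M) = 0.
Proof.
apply/funext => b; rewrite koszulE.
by case: ifP => _ //; apply: oppr0.
Qed.

Lemma vfN (A : 'I_n -> lfun M) i : (- A) i = - A i. Proof. by []. Qed.

Local Notation B := (bprod Psi Psi).

(** The rows of the product of [Psi] with itself: again homogeneous, of total
    degree 4 with the holomorphic slot. *)
Lemma sqPsi_su : B su = 0.
Proof. by apply/funext => b; rewrite bprodE !PsiE koszul_arow2 cmul_arow22. Qed.

Lemma sqPsi_sA k :
  B (sA k) = arow3 (- 2 *: (\sum_j g k j * pdbar j phibar + v k * phibar)).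
Proof.
apply/funext => b; rewrite bprodE !PsiE koszul_arow2 koszul_even //.
rewrite cmul_arow21 cmul_arow12; case: b => [|l||l||] /=; rewrite ?addr0 //.
apply: lfP => a z; rewrite !lfE.
under eq_bigr do rewrite lfM mulrC -lfM.
move: (\sum_j _) => S; ring.
Qed.

Lemma sqPsi_st : B st = arow3 (2 *: \sum_j vbar j * pdbar j phibar).
Proof.
apply/funext => b; rewrite bprodE !PsiE koszul_arow2 koszul_even //.
rewrite cmul_arow21 cmul_arow12; case: b => [|l||l||] /=; rewrite ?addr0 //.
apply: lfP => a z; rewrite !lfE.
have -> : \sum_(i < n) (pdbar i phibar * (- vbar) i) a z =
  - \sum_(i < n) (vbar i * pdbar i phibar) a z.
  by rewrite -sumrN; apply: eq_bigr => i _; rewrite vfN !lfE; ring.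
have -> : \sum_(i < n) ((- vbar) i * pdbar i phibar) a z =
  - \sum_(i < n) (vbar i * pdbar i phibar) a z.
  by rewrite -sumrN; apply: eq_bigr => i _; rewrite vfN !lfE; ring.
move: (\sum_i _) => S; ring.
Qed.

Lemma sqPsi_st2 : B st2 = arow2 (fun l => 2 *: (phi * vbar l)) (2 *: (phi * phibar)).
Proof.
apply/funext => b; rewrite bprodE !PsiE koszul_arow2 koszul_arow0.
rewrite cmul_arow02 cmul_arow20; case: b => [|l||l||] /=; rewrite ?addr0 //;
 by apply: lfP => a z; rewrite !lfE; ring.
Qed.

Lemma sqPsi_su2 : B su2 =
  arow1 (fun l => 2 *: (phi * vbar l - \sum_i pd i phi * g i l))
       (- 2 *: \sum_i v i * pd i phi).
Proof.
apply/funext => b; rewrite bprodE !PsiE koszul0 cmul0r cmul0l.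
under eq_bigr do rewrite !PsiE pdrow_arow0 koszul_even // cmul_arow10.
under [X in _ - _ - X - _ - _]eq_bigr do
  rewrite !PsiE koszul_arow0 pdrow_arow0 cmul_arow01.
rewrite koszul_even // koszul_arow0 cmul_arow10 cmul_arow01.
case: b => [|l||l||] /=; rewrite ?big1_eq ?subr0 ?addr0 //.
- apply: lfP => a z; rewrite vfN !lfE.
  have -> : \sum_(i < n) (g i l * pd i phi) a z = \sum_(i < n) (pd i phi * g i l) a z.
    by apply: eq_bigr => i _; rewrite !lfE; ring.
  move: (\sum_j _) => S; ring.
- apply: lfP => a z; rewrite !lfE.
  have -> : \sum_(i < n) (pd i phi * v i) a z = \sum_(i < n) (v i * pd i phi) a z.
    by apply: eq_bigr => i _; rewrite !lfE; ring.
  move: (\sum_j _) => S; ring.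
Qed.

(** Up to sign, the left-hand side of condition 2 with the vector field
    replaced by 2 v - 2 vbar; it is what the product of [Psi] with itself
    contains in bidegree (2, 2), vector times vector. *)
Definition defect k l : lfun M := - 2 *:
  (\sum_(i < n) (\sum_(j < n) (g i j * pdbar j (pd i (g k l)) - pd i (g k j) * pdbar j (g i l))
           + (v i * pd i (g k l) - pd i (v k) * g i l))
   - \sum_(j < n) (vbar j * pdbar j (g k l) - pdbar j (vbar l) * g k j)).

Lemma pdN i (h : lfun M) : pd i (- h) = - pd i h. Proof. exact: (pdCN (inl i)). Qed.
Lemma pdbarN i (h : lfun M) : pdbar i (- h) = - pdbar i h.
Proof. exact: (pdCN (inr i)). Qed.

Lemma sqPsi_sA2 k : B (sA2 k) = arow2 (defect k) (2 *: (v k * phibar)).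
Proof.
apply/funext => b; rewrite bprodE !PsiE koszul_arow2 koszul_arow0.
rewrite !koszul_arow1 // opprK oppr0 !cmul_arow11 cmul_arow20 cmul_arow02.
under eq_bigr => i _ do
  rewrite !PsiE koszul_arow1 // !pdrow_arow1 !cmul_arow11.
case: b => [|l||l||] /=; rewrite ?subr0 ?addr0 ?big1_eq ?subr0 ?addr0 //; last first.
  by apply: lfP => a z; rewrite !lfE; ring.
rewrite (eq_bigr (fun i => 2 *: (\sum_j (g i j * pdbar j (pd i (g k l)) -
    pd i (g k j) * pdbar j (g i l)) + (v i * pd i (g k l) - pd i (v k) * g i l))));
  last first.
  move=> i _.
  rewrite (eq_bigr (fun j => - (g i j * pdbar j (pd i (g k l)) -
    pd i (g k j) * pdbar j (g i l)))); last first.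
    by move=> j _; rewrite !vfN pdbarN; apply: lfP => a z; rewrite !lfE; ring.
  rewrite [X in _ - (- X - _ + _)](eq_bigr (fun j =>
    g i j * pdbar j (pd i (g k l)) - pd i (g k j) * pdbar j (g i l))); last first.
    by move=> j _; rewrite !vfN !pdN pdbarN; apply: lfP => a z; rewrite !lfE; ring.
  rewrite sumrN !vfN !pdN; move: (\sum_j _) => S.
  by apply: lfP => a z; rewrite !lfE; ring.
rewrite -scaler_sumr /defect; move: (\sum_i _) => S.
rewrite [X in _ + (- X - _ + _)](eq_bigr (fun j =>
    - (vbar j * pdbar j (g k l) - pdbar j (vbar l) * g k j))); last first.
  by move=> j _; rewrite !vfN !pdbarN; apply: lfP => a z; rewrite !lfE; ring.
rewrite sumrN !vfN; move: (\sum_j _) => T.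
by apply: lfP => a z; rewrite !lfE; ring.
Qed.

End Psi.

(** * The Maurer-Cartan equation in components *)
Section Bracket.
Variables (R : realType) (n : nat) (M : complex_manifold R n).
Implicit Types (x y : bfam M).

Lemma bprod0l y : bprod 0 y = 0.
Proof.
apply/funext => s; apply/funext => b; rewrite bprod_sum chprod_graded; first last.
- exact: pdrow0.
- exact: cmul0r.
have P0 i : pdrow i 0 = (0 : slot n -> lfun M) by exact: pdrow0.
have Z s' : (0 : bfam M) s' = 0 by [].
case: s => [|k||k||] /=; rewrite ?Z ?koszul0 ?cmul0l ?big1 ?subr0 ?addr0 // => i _;
 by rewrite ?Z ?koszul0 ?P0 ?cmul0l ?subr0.
Qed.

Lemma bprod0r x : bprod x 0 = 0.
Proof.
apply/funext => s; apply/funext => b; rewrite bprod_sum chprod_graded; first last.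
- exact: pdrow0.
- exact: cmul0r.
have P0 i : pdrow i 0 = (0 : slot n -> lfun M) by exact: pdrow0.
have Z s' : (0 : bfam M) s' = 0 by [].
case: s => [|k||k||] /=; rewrite ?Z ?koszul0 ?cmul0r ?big1 ?subr0 ?addr0 // => i _;
 by rewrite ?Z ?koszul0 ?P0 ?cmul0r ?subr0.
Qed.

(** The bracket measures the failure of [bminus] to be a derivation, so only
    one of its three terms survives here. *)
Lemma bbracket_bminus_closed x y : bminus x = 0 -> bminus y = 0 ->
  bbracket 2 x y = bminus (bprod x y).
Proof.
have E (W : lmodType R[i]) (u : W) : (-1) ^+ 2 *: (u - 0 - (-1) ^+ 2 *: 0) = u.
  by rewrite scaler0 !subr0 sqrrN expr1n scale1r.
move=> bx by0; rewrite /bbracket bx by0.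
rewrite (bprod0l y).
rewrite (bprod0r x).
apply/funext => a; apply/funext => b.
exact: (E (lfun M) (bminus (bprod x y) a b)).
Qed.

Lemma bminus_mkPsi g vbar v phi phibar : bminus (@mkPsi R n M g vbar v phi phibar) = 0.
Proof.
apply/funext => a; apply/funext => b; apply: lfP => c z.
by case: a b => [|k||k||] [|l||l||]; rewrite /bminus /chb /= !lfE /=
  ?expr0 ?expr1 ?sqrrN ?expr1n; rewrite ?lfE; ring.
Qed.

End Bracket.

Section Components.
Variables (R : realType) (n : nat) (M : complex_manifold R n).
Variables (g : 'I_n -> 'I_n -> lfun M) (vbar v : 'I_n -> lfun M).
Variables (phi phibar f : lfun M).
Local Notation Psi := (mkPsi g vbar v phi phibar).

(** [defect] and the two scalar divergences occur twice: [bminus] sends a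
    component of bidegree (p, q) to (p - 1, q) and to (p, q - 1), and [Psi]
    itself contains v and vbar twice. *)
Definition mc_table (a b : slot n) : lfun M :=
  match a, b with
  | su, su2 => 2^-1 *: div01 f vbar + \sum_j vbar j * pdbar j phibar
  | sA k, sA2 l => - (2^-1 *: defect g vbar v k l)
  | sA k, st2 => 2^-1 *: div01 f (g k) + \sum_j g k j * pdbar j phibar - v k
  | st, st2 => - (2^-1 *: div01 f vbar + \sum_j vbar j * pdbar j phibar)
  | sA2 k, sA l => 2^-1 *: defect g vbar v k l
  | st2, sA l => - (2^-1 *: div10 f (g^~ l) - \sum_i pd i phi * g i l) - vbar l
  | st2, st => - (2^-1 *: div10 f v - \sum_i v i * pd i phi)
  | su2, su => 2^-1 *: div10 f v - \sum_i v i * pd i phi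
  | _, _ => 0
  end.

Lemma div10_0 : div10 f (fun=> 0) = 0.
Proof. by apply: big1 => i _; rewrite pd0 mulr0 addr0. Qed.
Lemma div01_0 : div01 f (fun=> 0) = 0.
Proof. by apply: big1 => i _; rewrite pdbar0 mulr0 addr0. Qed.
Lemma div01N (A : 'I_n -> lfun M) : div01 f (fun k => - A k) = - div01 f A.
Proof. by rewrite /div01 -sumrN; apply: eq_bigr => i _; rewrite pdbarN mulrN opprD. Qed.

(** The terms v phibar cancel between the images under [bminus] of the
    components of bidegrees (2, 2) and (1, 3) of the product, and the terms
    phi vbar between those of bidegrees (2, 2) and (3, 1). *)
Lemma maurer_cartan_table a b :
  (bQ f Psi + 2^-1 *: bbracket 2 Psi Psi) a b = mc_table a b.
Proof.
rewrite bbracket_bminus_closed ?bminus_mkPsi //.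
have -> : (bQ f Psi + 2^-1 *: bminus (bprod Psi Psi)) a b =
   bQ f Psi a b + 2^-1 *: bminus (bprod Psi Psi) a b by [].
have Bsu := sqPsi_su g vbar v phi phibar; have BsA := sqPsi_sA g vbar v phi phibar.
have Bst := sqPsi_st g vbar v phi phibar; have BsA2 := sqPsi_sA2 g vbar v phi phibar.
have Bst2 := sqPsi_st2 g vbar v phi phibar; have Bsu2 := sqPsi_su2 g vbar v phi phibar.
move: (bprod _ _) Bsu BsA Bst BsA2 Bst2 Bsu2 => P Bsu BsA Bst BsA2 Bst2 Bsu2.
case: a b => [|k||k||] [|l||l||]; rewrite /bQ /bminus /chQ /chb /=
  ?Bsu ?BsA ?Bst ?BsA2 ?Bst2 ?Bsu2 /= ?div10_0 ?div01_0 ?div01N;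
  apply: lfP => c z; rewrite !lfE /=.
all: try ring.
all: move: (\sum_(i < n) _) => S.
- by rewrite expr0; field.
- by rewrite expr1; field.
- by rewrite expr1; field.
- by rewrite sqrrN expr1n; field.
- by rewrite sqrrN expr1n; field.
- by rewrite exprS sqrrN expr1n; field.
Qed.
End Components.

(** * Divergences and Lie derivatives *)
Section Divergence.
Variables (R : realType) (n : nat) (M : complex_manifold R n).
Implicit Types (f h : lfun M) (A B : 'I_n -> lfun M) (g : 'I_n -> 'I_n -> lfun M).

Lemma diffableM_sum (I : Type) (r : seq I) (F : I -> lfun M) :
  (forall i, diffableM (F i)) -> diffableM (\sum_(i <- r) F i).
Proof.
move=> dF; elim/big_rec: _ => [|i h _ dh]; first exact/smoothM_diffableM/smoothM0.
by rewrite -[F i]scale1r; apply: diffableM_lin.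
Qed.

Lemma pdC_sum (I : Type) (r : seq I) (F : I -> lfun M) K a z :
  (forall i, diffableM (F i)) -> cod a z ->
  pdC K (\sum_(i <- r) F i) a z = \sum_(i <- r) pdC K (F i) a z.
Proof.
move=> dF az; elim: r => [|i r IH]; first by rewrite !big_nil pdC0.
by rewrite !big_cons pdCD ?IH //; exact: diffableM_sum.
Qed.

Lemma div10_congr f A B : (forall i, eqM (A i) (B i)) -> eqM (div10 f A) (div10 f B).
Proof.
move=> E a z az; rewrite /div10 /div01 !lfE; apply: eq_bigr => i _.
by have /= Ei := pdC_congr (inl i) (E i) az; rewrite !lfE (E i a z az) Ei.
Qed.

Lemma div01_congr f A B : (forall i, eqM (A i) (B i)) -> eqM (div01 f A) (div01 f B).
Proof.
move=> E a z az; rewrite /div10 /div01 !lfE; apply: eq_bigr => i _.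
by have /= Ei := pdC_congr (inr i) (E i) az; rewrite !lfE (E i a z az) Ei.
Qed.

Lemma div10Z f c A : (forall i, diffableM (A i)) ->
  eqM (div10 f (fun i => c *: A i)) (c *: div10 f A).
Proof.
move=> dA a z az; rewrite lfZ /div10 /div01 !lfE mulr_sumr; apply: eq_bigr => i _.
by have /= Ei := pdCZ (inl i) c (dA i) az; rewrite !lfE Ei; ring.
Qed.

Lemma div01Z f c A : (forall i, diffableM (A i)) ->
  eqM (div01 f (fun i => c *: A i)) (c *: div01 f A).
Proof.
move=> dA a z az; rewrite lfZ /div10 /div01 !lfE mulr_sumr; apply: eq_bigr => i _.
by have /= Ei := pdCZ (inr i) c (dA i) az; rewrite !lfE Ei; ring.
Qed.

(** After Leibniz the two sides differ by the order of mixed derivatives of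
    [g], and by mixed derivatives of [f], which vanish. *)
Lemma div_comm f g : smoothM f -> pluriharmonic f -> (forall i j, smoothM (g i j)) ->
  eqM (div01 f (fun j => div10 f (fun i => g i j))) (divdivg f g).
Proof.
move=> sf pf sg a z az; rewrite /divdivg /div10 /div01 !lfE.
have dpd K h : smoothM h -> diffableM (pdC K h).
  by move=> sh; exact/smoothM_diffableM/smoothM_pdC.
have dsum (h1 h2 : lfun M) : diffableM h1 -> diffableM h2 -> diffableM (h1 + h2).
  by move=> d1 d2; rewrite -[h1]scale1r; exact: diffableM_lin.
have dg i j := smoothM_diffableM (sg i j).
have d10 i j : diffableM (pd i (g i j) + pd i f * g i j).
  by apply: dsum; [exact: (dpd (inl i))|apply: diffableM_mul => //; exact: (dpd (inl i))].
have d01 i j : diffableM (pdbar j (g i j) + pdbar j f * g i j).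
  by apply: dsum; [exact: (dpd (inr j))|apply: diffableM_mul => //; exact: (dpd (inr j))].
have E1 j : pdbar j (\sum_i (pd i (g i j) + pd i f * g i j)) a z =
    \sum_i pdbar j (pd i (g i j) + pd i f * g i j) a z.
  exact: (pdC_sum _ (inr j) (d10^~ j) az).
have E2 i : pd i (\sum_j (pdbar j (g i j) + pdbar j f * g i j)) a z =
    \sum_j pd i (pdbar j (g i j) + pdbar j f * g i j) a z.
  exact: (pdC_sum _ (inl i) (d01 i) az).
under eq_bigr do rewrite !lfE E1 mulr_sumr -big_split.
under [RHS]eq_bigr do rewrite !lfE E2 mulr_sumr -big_split.
rewrite exchange_big; apply: eq_bigr => i _; apply: eq_bigr => j _ /=.
have pf' : pdbar j (pd i f) a z = 0.
  by have /= -> := pdC_comm (inr j) (inl i) sf az; exact: pf.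
have := pdCD (inr j) (dpd (inl i) _ (sg i j)) (diffableM_mul (dpd (inl i) _ sf) (dg i j)) az.
move=> /= ->.
have := pdCD (inl i) (dpd (inr j) _ (sg i j)) (diffableM_mul (dpd (inr j) _ sf) (dg i j)) az.
move=> /= ->.
have := pdC_mul (inr j) (dpd (inl i) _ sf) (dg i j) az; move=> /= ->.
have := pdC_mul (inl i) (dpd (inr j) _ sf) (dg i j) az; move=> /= ->.
rewrite !lfE pf' (pf i j a z az) lf0.
have := pdC_comm (inr j) (inl i) (sg i j) az; move=> /= ->.
ring.
Qed.

End Divergence.

Section LieDerivative.
Variables (R : realType) (n : nat) (M : complex_manifold R n).
Variables (X : 'I_n + 'I_n -> lfun M) (g : 'I_n -> 'I_n -> lfun M).

Lemma lie_bivec_mixed k l : lie_bivec X (bivec g) (inl k) (inr l) =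
  \sum_i (X (inl i) * pd i (g k l) - pd i (X (inl k)) * g i l) +
  \sum_j (X (inr j) * pdbar j (g k l) - pdbar j (X (inr l)) * g k j).
Proof.
rewrite /lie_bivec big_sumType /=; congr (_ + _); apply: eq_bigr => i _;
  by rewrite !mulr0 !subr0.
Qed.

(** The Lie derivative of [g] has no component of type (2, 0) or (0, 2), since
    the (1, 0) part of the vector field has no antiholomorphic derivative and
    conversely. *)
Lemma lie_bivec_pure I J : hol_transformation X ->
  (if I is inl _ then if J is inr _ then false else true else true) ->
  eqM (lie_bivec X (bivec g) I J) 0.
Proof.
move=> [[_ hX] [_ aX]] IJ a z az; rewrite /lie_bivec big_sumType /= !lfE.
rewrite !big1 ?addr0 // => i _; rewrite !lfE; case: I J IJ => [k|k] [l|l] //= _;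
  rewrite ?pd0 ?pdbar0 ?lf0 ?(hX _ _ a z az) ?(aX _ _ a z az) ?lf0; ring.
Qed.

End LieDerivative.

(** * From the volume form Omega' to the volume form Omega *)
Section LogDensity.
Variables (R : realType) (n : nat) (M : complex_manifold R n).
Variables (Phi0' phi phibar : lfun M).
Hypotheses (sPhi : smoothM Phi0') (sphi : smoothM phi) (sphibar : smoothM phibar).
Local Notation f' := ((- 2) *: Phi0').
Local Notation f := (log_density Phi0' phi phibar).

Lemma smoothMD (h k : lfun M) : smoothM h -> smoothM k -> smoothM (h + k).
Proof. by move=> sh sk; rewrite -[h]scale1r; exact: smoothM_lin. Qed.

Lemma smoothMB (h k : lfun M) : smoothM h -> smoothM k -> smoothM (h - k).
Proof. by move=> sh sk; rewrite -[- k]scaleN1r; apply: smoothMD => //; exact: smoothMZ. Qed.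

Lemma smoothM_log_density : smoothM f.
Proof. exact/smoothMZ/smoothMB/sphibar/smoothMD. Qed.

Lemma pdC_log_density K a z : cod a z ->
  pdC K f a z = pdC K f' a z - 2 * pdC K phi a z + 2 * pdC K phibar a z.
Proof.
move=> az; have d h (sh : smoothM h) := @smoothM_diffableM R n M h sh.
have s1 := smoothMD sPhi sphi; have s2 := smoothMB s1 sphibar.
rewrite /log_density (pdCZ K _ (d _ s2) az) (pdCZ K _ (d _ sPhi) az).
have sN : smoothM (- phibar) by rewrite -scaleN1r; exact: smoothMZ.
rewrite (pdCD K (d _ s1) (d _ sN) az) (pdCD K (d _ sPhi) (d _ sphi) az) pdCN lfN.
move: (pdC K Phi0' a z) (pdC K phi a z) (pdC K phibar a z) => p q r; ring.
Qed.

Hypotheses (hphi : is_hol phi) (aphibar : is_antihol phibar).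

(** Only phibar has antiholomorphic derivatives; so the passage from Omega' to
    Omega adds to the (0, 1) divergence exactly the term produced by the bracket. *)
Lemma div01_log_density A : eqM (div01 f A)
  (div01 f' A + 2 *: \sum_j A j * pdbar j phibar).
Proof.
move=> a z az; rewrite lfD lfZ /div01 !lfE mulr_sumr -big_split.
apply: eq_bigr => j _; rewrite !lfE.
have /= -> := pdC_log_density (inr j) az; rewrite (hphi _ az) lf0.
move: (pdbar j (A j) a z) (pdbar j f' a z) (pdbar j phibar a z) => p q r; ring.
Qed.

Lemma div10_log_density A : eqM (div10 f A)
  (div10 f' A - 2 *: \sum_i pd i phi * A i).
Proof.
move=> a z az; rewrite lfD lfN lfZ /div10 !lfE mulr_sumr -sumrN -big_split.
apply: eq_bigr => j _; rewrite !lfE.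
have /= -> := pdC_log_density (inl j) az; rewrite (aphibar _ az) lf0.
move: (pd j (A j) a z) (pd j f' a z) (pd j phi a z) => p q r; ring.
Qed.

Hypothesis (hpluri : pluriharmonic Phi0').

Lemma pluriharmonic_potential : pluriharmonic (Phi0' + phi - phibar).
Proof.
move=> i j.
have s1 := smoothMD sPhi sphi.
have sN : smoothM (- phibar) by rewrite -scaleN1r; exact: smoothMZ.
have d h (sh : smoothM h) := @smoothM_diffableM R n M h sh.
have dp K h (sh : smoothM h) := d _ (smoothM_pdC K sh).
have E : eqM (pdbar j (Phi0' + phi - phibar)) (pdbar j Phi0' - pdbar j phibar).
  move=> a z az; have /= -> := pdCD (inr j) (d _ s1) (d _ sN) az.
  have /= -> := pdCD (inr j) (d _ sPhi) (d _ sphi) az.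
  by rewrite (hphi _ az) lf0 addr0 pdbarN.
apply: eqM_trans (pdC_congr (inl i) E) _ => a z az /=.
have dN : diffableM (- pdbar j phibar).
  by rewrite -scaleN1r; apply/smoothM_diffableM/smoothMZ/(smoothM_pdC (inr j)).
have /= -> := pdCD (inl i) (dp (inr j) _ sPhi) dN az.
rewrite (hpluri i j az) lf0 add0r pdN lfN.
have /= -> := pdC_comm (inl i) (inr j) sphibar az.
have /= -> := pdC_congr (inr j) (@aphibar i) az.
by rewrite pdbar0 lf0 oppr0.
Qed.

Lemma pluriharmonic_log_density : pluriharmonic f.
Proof.
move=> i j; have s2 := smoothMB (smoothMD sPhi sphi) sphibar.
have E : eqM (pdbar j f) (-2 *: pdbar j (Phi0' + phi - phibar)).
  by move=> a z az; exact: (pdCZ (inr j) _ (smoothM_diffableM s2) az).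
apply: eqM_trans (pdC_congr (inl i) E) _ => a z az.
have /= -> := pdCZ (inl i) (-2) (smoothM_diffableM (smoothM_pdC (inr j) s2)) az.
by rewrite (pluriharmonic_potential i j az) lf0 mulr0.
Qed.

Variables (g : 'I_n -> 'I_n -> lfun M).
Variables (vbar v : 'I_n -> lfun M).

Lemma maurer_cartanP : maurer_cartan f' (mkPsi g vbar v phi phibar) <->
  [/\ (forall k, eqM (v k) (2^-1 *: divg f g (inl k))),
      (forall l, eqM (vbar l) (- (2^-1 *: divg f g (inr l)))),
      eqM (div10 f v) 0, eqM (div01 f vbar) 0 &
      forall k l, eqM (defect g vbar v k l) 0].
Proof.
have half (x : R[i]) : 2^-1 * (2 * x) = x by field.
have E1 := div01_log_density; have E2 := div10_log_density.
have commr (F G : 'I_n -> lfun M) a z : \sum_i (F i * G i) a z = \sum_i (G i * F i) a z.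
  by apply: eq_bigr => i _; rewrite !lfE mulrC.
(* the components of the table in terms of Omega instead of Omega' *)
have Tv a z : cod a z ->
    mc_table g vbar v phi phibar f' su2 su a z = 2^-1 * div10 f v a z.
  move=> az; rewrite (E2 v a z az) /= !lfE (commr (fun i => pd i phi)).
  by move: (\sum_i _) (div10 _ _ _ _) => p q; field.
have Tvbar a z : cod a z ->
    mc_table g vbar v phi phibar f' su su2 a z = 2^-1 * div01 f vbar a z.
  move=> az; rewrite (E1 vbar a z az) /= !lfE.
  by move: (\sum_i _) (div01 _ _ _ _) => p q; field.
have Tk k a z : cod a z -> mc_table g vbar v phi phibar f' (sA k) st2 a z =
    2^-1 * divg f g (inl k) a z - v k a z.
  move=> az; have -> : divg f g (inl k) a z = _ := E1 (g k) a z az.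
  by rewrite /= !lfE; move: (\sum_i _) (div01 _ _ _ _) => p q; field.
have Tl l a z : cod a z -> mc_table g vbar v phi phibar f' st2 (sA l) a z =
    - (2^-1 * divg f g (inr l) a z) - vbar l a z.
  move=> az; have -> : divg f g (inr l) a z = _ := E2 (g^~ l) a z az.
  by rewrite /= !lfE; move: (\sum_i _) (div10 _ _ _ _) => p q; field.
have h0 (x : R[i]) : 2^-1 * x = 0 -> x = 0.
  by move=> x0; rewrite -(half x) mulrCA x0 mulr0.
split=> [mc|[Ek El Ev Evb Ed] a b c z cz].
  have mc' a b c z : cod c z -> mc_table g vbar v phi phibar f' a b c z = 0.
    by move=> cz; rewrite -maurer_cartan_table; exact: mc.
  split.
  - move=> k a z az; have := mc' (sA k) st2 a z az; rewrite Tk // lfZ => /eqP.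
    by rewrite subr_eq0 => /eqP.
  - move=> l a z az; have := mc' st2 (sA l) a z az; rewrite Tl // lfN lfZ => /eqP.
    by rewrite subr_eq0 => /eqP.
  - by move=> a z az; apply: h0; rewrite -Tv // mc'.
  - by move=> a z az; apply: h0; rewrite -Tvbar // mc'.
  - by move=> k l a z az; apply: h0; exact: (mc' (sA2 k) (sA l)).
rewrite maurer_cartan_table.
case: a b => [|k||k||] [|l||l||] //.
- by rewrite Tvbar // Evb // lf0 mulr0.
- by rewrite /= lfN lfZ Ed // lf0 mulr0 oppr0.
- by rewrite Tk // Ek // lfZ subrr.
- by have := Tvbar c z cz; rewrite /= lfN => ->; rewrite Evb // lf0 mulr0 oppr0.
- by rewrite /= lfZ Ed // lf0 mulr0.
- by rewrite Tl // El // lfN lfZ subrr.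
- by have := Tv c z cz; rewrite /= lfN => ->; rewrite Ev // lf0 mulr0 oppr0.
- by rewrite Tv // Ev // lf0 mulr0.
Qed.

End LogDensity.

Section Conditions.
Variables (R : realType) (n : nat) (M : complex_manifold R n).

(** The factor 2 in [defect] comes from the symmetry of [[g, g]] on the one
    hand and from X = 2 v - 2 vbar on the other. *)
Lemma defect_lie (g : 'I_n -> 'I_n -> lfun M) (vbar v : 'I_n -> lfun M)
    (X : 'I_n + 'I_n -> lfun M) k l :
  (forall i j, smoothM (g i j)) -> (forall i, smoothM (v i)) ->
  (forall j, smoothM (vbar j)) ->
  (forall i, eqM (X (inl i)) (2 *: v i)) ->
  (forall j, eqM (X (inr j)) (- 2 *: vbar j)) ->
  eqM (dbracket g g k l + lie_bivec X (bivec g) (inl k) (inr l))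
      (- defect g vbar v k l).
Proof.
move=> sg sv svb Xv Xvb a z az; rewrite lie_bivec_mixed /dbracket /defect !lfE.
have pX i k' : pd i (X (inl k')) a z = 2 * pd i (v k') a z.
  have /= -> := pdC_congr (inl i) (Xv k') az.
  exact: (pdCZ (inl i) 2 (smoothM_diffableM (sv k')) az).
have pXb j l' : pdbar j (X (inr l')) a z = -2 * pdbar j (vbar l') a z.
  have /= -> := pdC_congr (inr j) (Xvb l') az.
  exact: (pdCZ (inr j) (-2) (smoothM_diffableM (svb l')) az).
have -> : \sum_(i < n) (\sum_(j < n) (g i j * pd i (pdbar j (g k l)) +
    g i j * pd i (pdbar j (g k l)) - pd i (g k j) * pdbar j (g i l) -
    pd i (g k j) * pdbar j (g i l))) a z =
  2 * \sum_(i < n) (\sum_(j < n) (g i j * pdbar j (pd i (g k l)) -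
    pd i (g k j) * pdbar j (g i l))) a z.
  rewrite mulr_sumr; apply: eq_bigr => i _; rewrite !lfE mulr_sumr.
  apply: eq_bigr => j _; rewrite !lfE.
  have /= -> := pdC_comm (inl i) (inr j) (sg k l) az.
  move: (pdbar j (pd i (g k l)) a z) (pd i (g k j) a z) (pdbar j (g i l) a z)
    (g i j a z) => p q r s.
  by ring.
have -> : \sum_(i < n) (X (inl i) * pd i (g k l) - pd i (X (inl k)) * g i l) a z =
    2 * \sum_(i < n) (v i * pd i (g k l) - pd i (v k) * g i l) a z.
  rewrite mulr_sumr; apply: eq_bigr => i _; rewrite !lfE pX (Xv i a z az) lfZ.
  move: (pd i (g k l) a z) (pd i (v k) a z) => p q; by ring.
have -> : \sum_(i < n) (X (inr i) * pdbar i (g k l) - pdbar i (X (inr l)) * g k i) a z =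
    -2 * \sum_(i < n) (vbar i * pdbar i (g k l) - pdbar i (vbar l) * g k i) a z.
  rewrite mulr_sumr; apply: eq_bigr => i _; rewrite !lfE pXb (Xvb i a z az) lfZ.
  move: (pdbar i (g k l) a z) (pdbar i (vbar l) a z) => p q; by ring.
under [X in _ = - (_ * (X - _))]eq_bigr do rewrite lfD.
rewrite [X in _ = - (_ * (X - _))]big_split /=.
by move: (\sum_i _) (\sum_i _) (\sum_i _) => p q r; ring.
Qed.

(** For the converse, v and vbar are defined as halves of the components of
    div_Omega g, up to sign; then div_Omega vbar = 0 follows from condition 3
    because the two divergences commute. *)
Lemma maurer_cartan_conditions (Phi0' : lfun M) (hvol : volume_potential Phi0')
    (hpluri : pluriharmonic Phi0') (g : 'I_n -> 'I_n -> lfun M) (phi phibar : lfun M) :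
  smooth_bivector g -> hol_fun phi -> antihol_fun phibar ->
  let f' := (- 2) *: Phi0' in let f := log_density Phi0' phi phibar in
     (forall vbar v : 'I_n -> lfun M, antihol_vf vbar -> hol_vf v ->
        maurer_cartan f' (mkPsi g vbar v phi phibar) ->
        (forall i, eqM (v i) (2^-1 *: divg f g (inl i))) /\
        (forall j, eqM (vbar j) (- (2^-1 *: divg f g (inr j))))) /\
     ((exists vbar v : 'I_n -> lfun M,
         [/\ antihol_vf vbar, hol_vf v &
             maurer_cartan f' (mkPsi g vbar v phi phibar)])
      <->
      [/\ pluriharmonic (Phi0' + phi - phibar) /\
          hol_vf (fun i => divg f g (inl i)) /\
          antihol_vf (fun j => divg f g (inr j)),
          forall I J, eqM (bivec (dbracket g g) I J
                           + lie_bivec (divg f g) (bivec g) I J) 0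
        & eqM (divdivg f g) 0]).
Proof.
move=> [sg _] [[sphi _] hphi] [[sphibar _] aphibar] f' f.
have [sPhi _] := hvol.
have sf : smoothM f by exact: smoothM_log_density.
have pf : pluriharmonic f by exact: pluriharmonic_log_density.
have MC v vbar := maurer_cartanP sPhi sphi sphibar hphi aphibar g vbar v.
have solve_scale (h k : lfun M) (c : R[i]) :
    c != 0 -> eqM h (c^-1 *: k) -> eqM k (c *: h).
  by move=> c0 E a z az; rewrite lfZ (E a z az) lfZ mulVKf.
have two0 : 2 != 0 :> R[i] by rewrite pnatr_eq0.
have halfN (k : lfun M) : - (2^-1 *: k) = (- 2)^-1 *: k.
  by rewrite invrN scaleNr.
split=> [vbar v _ _ /MC[Ev Evb _ _ _]|]; first by split.
split=> [[vbar [v [avb hv /MC[Ev Evb dv dvb Ed]]]]|[[_ [hd ad]] Edd div0]].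
- have Xv i : eqM (divg f g (inl i)) (2 *: v i) by exact: solve_scale.
  have Xvb j : eqM (divg f g (inr j)) (- 2 *: vbar j).
    by apply: solve_scale; [rewrite oppr_eq0|rewrite -halfN].
  have hX : hol_transformation (divg f g).
    split; first by apply: hol_vf_congr (hol_vfZ 2 hv) => i; apply: eqM_sym.
    by apply: antihol_vf_congr (antihol_vfZ (-2) avb) => i; apply: eqM_sym.
  have sv i := hv.1.1 i; have svb j := avb.1.1 j.
  split.
  + by split; [exact: pluriharmonic_potential|exact: hX].
  + have pure I J : bivec (dbracket g g) I J = 0 ->
        (if I is inl _ then if J is inr _ then false else true else true) ->
        eqM (bivec (dbracket g g) I J + lie_bivec (divg f g) (bivec g) I J) 0.
      by move=> -> IJ; rewrite add0r; exact: lie_bivec_pure.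
    case=> k [] l; try exact: pure.
    move=> a z az; rewrite [LHS](defect_lie k l sg sv svb Xv Xvb az).
    by rewrite lfN (Ed k l a z az) oppr0.
  + have E := @div10_congr _ _ _ f _ (fun i => 2 *: v i) Xv.
    apply: (@eqM_trans _ _ _ (divdivg f g) _ 0 E) => a z az.
    have dv' i := smoothM_diffableM (sv i).
    by rewrite (div10Z f 2 dv' az) lfZ (dv a z az) lf0 mulr0.
- pose v i := 2^-1 *: divg f g (inl i); pose vbar j := - (2^-1 *: divg f g (inr j)).
  have hv : hol_vf v by exact: hol_vfZ.
  have avb : antihol_vf vbar.
    by apply: antihol_vf_congr (antihol_vfZ (-2)^-1 ad) => i a z az; rewrite /vbar halfN.
  exists vbar, v; split=> //; apply/MC.
  have dd i := smoothM_diffableM (hd.1.1 i).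
  have ddb j := smoothM_diffableM (ad.1.1 j).
  split=> //.
  + move=> a z az; rewrite (div10Z f 2^-1 dd az) lfZ (_ : div10 f _ a z = 0) ?mulr0 //.
    exact: div0.
  + have Evb j : eqM (vbar j) ((-2)^-1 *: divg f g (inr j)) by rewrite /vbar halfN.
    have E := @div01_congr _ _ _ f _ (fun j => (-2)^-1 *: divg f g (inr j)) Evb.
    apply: eqM_trans E _ => a z az.
    rewrite (div01Z f _ ddb az) lfZ (_ : div01 f _ a z = 0) ?mulr0 //.
    exact: etrans (div_comm sf pf sg az) (div0 a z az).
  + move=> k l a z az; apply/eqP; rewrite -oppr_eq0 -lfN; apply/eqP.
    have Xv i : eqM (divg f g (inl i)) (2 *: v i) by exact: solve_scale.
    have Xvb j : eqM (divg f g (inr j)) (- 2 *: vbar j).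
      by apply: solve_scale; [rewrite oppr_eq0|rewrite -halfN].
    rewrite -(defect_lie k l sg (hv.1.1) (avb.1.1) Xv Xvb az).
    exact: (Edd (inl k) (inr l) a z az).
Qed.

End Conditions.

(** * Operations on tensor families modulo equality on the charts *)
Section Congruence.
Variables (R : realType) (n : nat) (M : complex_manifold R n).
Implicit Types (x y : bfam M) (u w : slot n -> lfun M) (h : lfun M).

Definition eqB x y : Prop := forall a b, eqM (x a b) (y a b).

Lemma eqMD h1 h2 k1 k2 : eqM h1 h2 -> eqM k1 k2 -> eqM (h1 + k1) (h2 + k2).
Proof. by move=> E E' a z az; rewrite !lfD E // E'. Qed.

Lemma eqMN h k : eqM h k -> eqM (- h) (- k).
Proof. by move=> E a z az; rewrite !lfN E. Qed.

Lemma eqMM h1 h2 k1 k2 : eqM h1 h2 -> eqM k1 k2 -> eqM (h1 * k1) (h2 * k2).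
Proof. by move=> E E' a z az; rewrite !lfM E // E'. Qed.

Lemma eqMZ c h k : eqM h k -> eqM (c *: h) (c *: k).
Proof. by move=> E a z az; rewrite !lfZ E. Qed.

Lemma cmul_congr u u' w w' : (forall b, eqM (u b) (u' b)) ->
  (forall b, eqM (w b) (w' b)) -> forall b, eqM (cmul u w b) (cmul u' w' b).
Proof.
move=> Eu Ew; apply: (chprod_compat (E := @eqM R n M)) => //.
- by move=> *; apply: eqMD.
- by move=> *; apply: eqMN.
- by move=> *; apply: eqMM.
- by move=> i h k E; exact: (pdC_congr (inr i)).
Qed.

Lemma bprod_congr x x' y y' : eqB x x' -> eqB y y' -> eqB (bprod x y) (bprod x' y').
Proof.
move=> Ex Ey s b; rewrite !bprod_sum !rows_sum => a z az; rewrite !lf_sum.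
apply: eq_bigr => q _; move: a z az.
pose E u w := forall b, eqM (u b) (w b).
apply: (chprod_compat (E := E)) => //.
- by move=> u u' w w' Eu Ew c; apply: eqMD; [exact: Eu|exact: Ew].
- by move=> u u' Eu c; apply: eqMN; exact: Eu.
- by move=> u u' w w' Eu Ew; exact: cmul_congr.
- by move=> i u u' Eu c; exact: (pdC_congr (inl i)).
- by move=> a c; apply: eqMZ; exact: Ex.
- by move=> a c; case: eqP => _ //; exact: Ey.
Qed.

Lemma chb_congr u w : (forall s, eqM (u s) (w s)) ->
  forall s, eqM (chb u s) (chb w s).
Proof. by move=> E [|k||k||] //=; apply: eqMN. Qed.

Lemma chQ_congr div u w :
  (forall A B, (forall k, eqM (A k) (B k)) -> eqM (div A) (div B)) ->
  (forall s, eqM (u s) (w s)) -> forall s, eqM (chQ div u s) (chQ div w s).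
Proof.
move=> Ed E [|k||k||] //=.
- by apply: eqMD => //; apply/eqMN/eqMZ/Ed => k.
- by apply/eqMZ/Ed => k.
Qed.

Lemma bminus_congr x y : eqB x y -> eqB (bminus x) (bminus y).
Proof.
move=> E a b; apply: eqMD; first by apply: chb_congr => s; exact: E.
by apply/eqMN/eqMZ/chb_congr => s; exact: E.
Qed.

Lemma bQ_congr f x y : eqB x y -> eqB (bQ f x) (bQ f y).
Proof.
move=> E a b; apply: eqMD.
  by apply: chQ_congr => [A B EA|s]; [exact: div10_congr|exact: E].
by apply/eqMZ/chQ_congr => [A B EA|s]; [exact: div01_congr|exact: E].
Qed.

Lemma symmetry_congr f x y y' : eqB y y' -> eqB (symmetry f y x) (symmetry f y' x).
Proof.
move=> E a b; apply: eqMD; first exact: bQ_congr.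
apply: eqMZ; apply: eqMD; first (apply: eqMD; first exact/bminus_congr/bprod_congr).
  by apply: eqMN; exact: bprod_congr.
apply/eqMN/eqMZ/bprod_congr => //; exact: bminus_congr.
Qed.

End Congruence.

(** * The change of Psi under an infinitesimal symmetry *)
Section Symmetry.
Variables (R : realType) (n : nat) (M : complex_manifold R n).

(** The general element of degree 1 killed by [bminus]: the relation
    b^- Lam = 0 forces the two scalar components to be the same constant. *)
Definition mkLam (A Abar : 'I_n -> lfun M) (t : lfun M) : bfam M := fun a b =>
  match a, b with
  | sA k, su => A k
  | su, sA l => Abar l
  | st, su => t
  | su, st => t
  | _, _ => 0
  end.

Variables (A Abar : 'I_n -> lfun M) (t : lfun M).
Local Notation Lam := (mkLam A Abar t).

Lemma Lam_su : Lam su = arow1 Abar t.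
Proof. by apply/funext => -[]. Qed.
Lemma Lam_sA k : Lam (sA k) = arow0 (A k).
Proof. by apply/funext => -[]. Qed.
Lemma Lam_st : Lam st = arow0 t.
Proof. by apply/funext => -[]. Qed.
Lemma Lam_sA2 k : Lam (sA2 k) = 0.
Proof. by apply/funext => -[]. Qed.
Lemma Lam_st2 : Lam st2 = 0.
Proof. by apply/funext => -[]. Qed.
Lemma Lam_su2 : Lam su2 = 0.
Proof. by apply/funext => -[]. Qed.
Definition LamE := (Lam_su, Lam_sA, Lam_st, Lam_sA2, Lam_st2, Lam_su2).

Lemma bminus_mkLam : bminus Lam = 0.
Proof.
apply/funext => a; apply/funext => b; apply: lfP => c z.
by case: a b => [|k||k||] [|l||l||]; rewrite /bminus /chb /= !lfE /=
  ?expr0 ?expr1 ?sqrrN ?expr1n; rewrite ?lfE; ring.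
Qed.

Variables (g : 'I_n -> 'I_n -> lfun M) (vbar v : 'I_n -> lfun M).
Variables (phi phibar f : lfun M).
Local Notation Psi := (mkPsi g vbar v phi phibar).

Lemma symmetry_mkLam a b : symmetry f Lam Psi a b =
  bQ f Lam a b + bminus (bprod Psi Lam) a b.
Proof. by rewrite /symmetry bbracket_bminus_closed ?bminus_mkPsi ?bminus_mkLam. Qed.

(** The terms t phi contributed by the two scalar components of [Lam] cancel. *)
Lemma symmetry_phi : phi_comp (symmetry f Lam Psi) =
  t - 2^-1 *: div10 f A + \sum_(i < n) A i * pd i phi.
Proof.
rewrite /phi_comp symmetry_mkLam /bQ /bminus /chQ /chb /=.
rewrite !bprodE !(PsiE, LamE) !(koszul0, cmul0r, cmul0l, pdrow0).
rewrite [X in _ - X - _ - _ - _]big1; last by move=> i _; rewrite pdrow0 cmul0r.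
under [X in _ - X - _ - _]eq_bigr do rewrite Lam_sA koszul_arow0 pdrow_arow0 cmul_arow00.
rewrite !koszul_arow0 cmul_arow00 cmul_arow01 /=.
apply: lfP => a z; rewrite !lfE sqrrN expr1n.
rewrite (eq_bigr (fun i => (A i * pd i phi) a z)); last by move=> i _; rewrite !lfE mulrC.
move: (\sum_(i < n) _) => S; ring.
Qed.

Lemma symmetry_phibar : phibar_comp (symmetry f Lam Psi) =
  t - 2^-1 *: div01 f Abar - \sum_(j < n) Abar j * pdbar j phibar.
Proof.
rewrite /phibar_comp symmetry_mkLam /bQ /bminus /chQ /chb /=.
rewrite !bprodE !(PsiE, LamE).
rewrite !koszul_arow2 koszul_even // cmul_arow20 cmul_arow11 cmul_arow21 /=.
apply: lfP => a z; rewrite !lfE expr0.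
rewrite (eq_bigr (fun j => (Abar j * pdbar j phibar) a z)); last first.
  by move=> j _; rewrite !lfE mulrC.
move: (\sum_(j < n) _) => S; ring.
Qed.

(** The terms containing t, v or vbar cancel between the components of
    bidegrees (2, 1) and (1, 2) of the product; what remains is the
    Lie derivative along A - Abar. *)
Lemma symmetry_g k l : g_comp (symmetry f Lam Psi) k l =
  \sum_(i < n) (A i * pd i (g k l) - pd i (A k) * g i l) -
  \sum_(j < n) (Abar j * pdbar j (g k l) - pdbar j (Abar l) * g k j).
Proof.
rewrite /g_comp symmetry_mkLam /bQ /bminus /chQ /chb /=.
rewrite !bprodE !(PsiE, LamE).
rewrite cmul0r koszul_arow0 cmul_arow01 !(koszul_arow1 (q := 1%N)) //.
rewrite koszul_arow2 koszul_even //.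
rewrite cmul_arow11 cmul_arow20 !cmul_arow10 /=.
rewrite (eq_bigr (fun i => - (- pd i (g k l) * A i + g i l * pd i (A k)))); last first.
  move=> i _; rewrite PsiE koszul_arow1 // pdrow_arow0 pdrow_arow1 /= !vfN pdN.
  by apply: lfP => a z; rewrite !lfE; ring.
have -> : (0 : slot n -> lfun M) (sA l) = 0 by [].
rewrite sumrN opprK !vfN opprK.
rewrite (eq_bigr (fun i => - (A i * pd i (g k l) - pd i (A k) * g i l))); last first.
  by move=> i _; apply: lfP => a z; rewrite !lfE; ring.
rewrite sumrN; move: (\sum_(i < n) (A i * _ - _)) => S.
rewrite (eq_bigr (fun j =>
  - (Abar j * pdbar j (g k l) - pdbar j (Abar l) * g k j))); last first.
  by move=> j _; apply: lfP => a z; rewrite !lfE; ring.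
rewrite sumrN; move: (\sum_(j < n) _) => T.
by apply: lfP => a z; rewrite !lfE expr1; ring.
Qed.

End Symmetry.

(** * Variation of the volume form *)
Section Density.
Variables (R : realType) (n : nat) (M : complex_manifold R n).

(** The logarithm of the density is affine in the parameter of the
    variation. *)
Lemma density_variationE (Phi0' phi phibar dphi dphibar : lfun M) a z :
  density_variation Phi0' phi phibar dphi dphibar a z =
  density (log_density Phi0' phi phibar) a z *
  (- 2 * (dphi a z - dphibar a z)).
Proof.
pose w (e : R) : R[i] := density (log_density Phi0' (phi + e%:C%C *: dphi)
  (phibar + e%:C%C *: dphibar)) a z.
change (Complex (derive1 (fun e => complex.Re (w e)) 0)
  (derive1 (fun e => complex.Im (w e)) 0) =
  density (log_density Phi0' phi phibar) a z * (- 2 * (dphi a z - dphibar a z))).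
pose G := log_density Phi0' phi phibar a z; pose H : R[i] := - 2 * (dphi a z - dphibar a z).
have wE : w = fun e : R => cexp (H * e%:C%C + G).
  apply/funext => e; rewrite /w /density; congr cexp.
  rewrite /G /H /log_density !lfE; ring.
have D0 : is_cderive (0 : R) 1 (fun e : R => e%:C%C) 1.
  by split => /=; [exact: is_derive_id|exact: is_derive_cst].
have D1 : is_cderive (0 : R) 1 (fun e : R => G) 0.
  by split; exact: is_derive_cst.
have [Dr Di] := is_cderive_cexp (is_cderive_lin H D0 D1).
rewrite wE !derive1E (@derive_val _ _ _ _ _ _ _ Dr) (@derive_val _ _ _ _ _ _ _ Di).
rewrite /density -/G -/H.
have -> : H * (0 : R)%:C%C + G = G by rewrite mulr0 add0r.
rewrite mulr1 addr0.
by case: (cexp G * H).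
Qed.

(** Cartan's formula for a top-degree form: the Lie derivative is the
    divergence times the form. *)
Lemma lie_vol_density (X : 'I_n + 'I_n -> lfun M) f :
  (forall K, smoothM (X K)) -> smoothM f ->
  eqM (lie_vol X (density f))
      (density f * (div10 f (fun i => X (inl i)) + div01 f (fun j => X (inr j)))).
Proof.
move=> sX sf a z az; have df := smoothM_diffableM sf.
have dd := diffableM_density df.
rewrite /lie_vol big_sumType /= !lfM lfD /div10 /div01 !lfE mulrDr !mulr_sumr.
congr (_ + _); apply: eq_bigr => i _; rewrite !lfE.
- have /= -> := pdC_mul (inl i) (smoothM_diffableM (sX (inl i))) dd az.
  have /= -> := pdC_density (inl i) df az.
  move: (pd _ _ _ _) (pd _ _ _ _) (density f a z) => p q r; by ring.
- have /= -> := pdC_mul (inr i) (smoothM_diffableM (sX (inr i))) dd az.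
  have /= -> := pdC_density (inr i) df az.
  move: (pdbar _ _ _ _) (pdbar _ _ _ _) (density f a z) => p q r; by ring.
Qed.

End Density.

Section Transformations.
Variables (R : realType) (n : nat) (M : complex_manifold R n).
Variable (Phi0' : lfun M).
Hypothesis (sPhi : smoothM Phi0').
Local Notation f' := ((- 2) *: Phi0').

Definition same_transformation (Lam : bfam M) (X : 'I_n + 'I_n -> lfun M) : Prop :=
  forall (g : 'I_n -> 'I_n -> lfun M) (vbar v : 'I_n -> lfun M)
            (phi phibar : lfun M),
       smooth_bivector g -> antihol_vf vbar -> hol_vf v ->
       hol_fun phi -> antihol_fun phibar ->
       let dPsi := symmetry f' Lam (mkPsi g vbar v phi phibar) in
       (forall I J, eqM (bivec (g_comp dPsi) I J) (lie_bivec X (bivec g) I J)) /\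
       eqM (density_variation Phi0' phi phibar (phi_comp dPsi) (phibar_comp dPsi))
           (lie_vol X (density (log_density Phi0' phi phibar))).

(** [Lam] is compared with its explicit model only on the ranges of the charts,
    where alone the components of a tensor family are meaningful. *)
Lemma same_transformation_mkLam Lam X t :
  eqB Lam (mkLam (fun i => X (inl i)) (fun j => - X (inr j)) t) ->
  hol_transformation X -> same_transformation Lam X.
Proof.
set A := fun i => X (inl i); set Abar := fun j => - X (inr j).
move=> EL hX g vbar v phi phibar [sg _] _ _ [[sphi _] hphi] [[sphibar _] aphibar].
have lieE k l : lie_bivec X (bivec g) (inl k) (inr l) =
    \sum_(i < n) (A i * pd i (g k l) - pd i (A k) * g i l) -
    \sum_(j < n) (Abar j * pdbar j (g k l) - pdbar j (Abar l) * g k j).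
  rewrite lie_bivec_mixed -sumrN; congr (_ + _).
  by apply: eq_bigr => j _; rewrite /Abar pdbarN !mulNr -opprB !opprK addrC.
set Psi := mkPsi _ _ _ _ _ => /=.
have ES := symmetry_congr f' Psi EL.
split.
  have pure I J : bivec (g_comp (symmetry f' Lam Psi)) I J = 0 ->
      (if I is inl _ then if J is inr _ then false else true else true) ->
      eqM (bivec (g_comp (symmetry f' Lam Psi)) I J) (lie_bivec X (bivec g) I J).
    by move=> -> IJ; apply: eqM_sym; exact: lie_bivec_pure.
  case=> k [] l; try exact: pure.
  apply: (eqM_trans (ES _ _)) => a z az.
  have -> : symmetry f' (mkLam A Abar t) Psi (sA k) (sA l) = _ :=
    symmetry_g A Abar t g vbar v phi phibar f' k l.
  by rewrite lieE.
move=> a z az; rewrite density_variationE.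
have sX K : smoothM (X K) by case: K => i; [exact: hX.1.1.1|exact: hX.2.1.1].
have sf := smoothM_log_density sPhi sphi sphibar.
rewrite (lie_vol_density sX sf az) lfM; congr (_ * _).
rewrite /phi_comp /phibar_comp (ES _ _ a z az) (ES su st2 a z az).
have -> : symmetry f' (mkLam A Abar t) Psi st2 su = _ :=
  symmetry_phi A Abar t g vbar v phi phibar f'.
have -> : symmetry f' (mkLam A Abar t) Psi su st2 = _ :=
  symmetry_phibar A Abar t g vbar v phi phibar f'.
have -> : (fun j => X (inr j)) = (fun j => - Abar j).
  by apply/funext => j; rewrite /Abar opprK.
rewrite div01N [RHS]lfD lfN -/A.
have E10 := div10_log_density sPhi sphi sphibar aphibar A az.
have E01 := div01_log_density sPhi sphi sphibar hphi Abar az.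
rewrite E10 E01 !lfE.
rewrite (eq_bigr (fun i => (pd i phi * A i) a z)); last by move=> i _; rewrite !lfE mulrC.
move: (div10 _ _ _ _) (div01 _ _ _ _) (\sum_(i < n) _) (\sum_(i < n) _) => p q r s.
by field.
Qed.

Lemma symmetry_transformation Lam : in_F 1 Lam -> bzero (bminus Lam) ->
  exists X : 'I_n + 'I_n -> lfun M, hol_transformation X /\ same_transformation Lam X.
Proof.
move=> [Ldeg [_ [L10 [L01 [_ [La [Lh _]]]]]]] bL.
pose X (K : 'I_n + 'I_n) : lfun M := match K with
  | inl i => Lam (sA i) su | inr j => - Lam su (sA j) end.
have hX : hol_transformation X.
  split; first by split; [exact: (L10 sA su (or_introl erefl))|move=> i; exact: Lh].
  have aL : antihol_vf (fun j => Lam su (sA j)).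
    by split; [exact: (L01 su sA _ (or_introl erefl))|move=> j; exact: La].
  by apply: antihol_vf_congr (antihol_vfZ (-1) aL) => j; rewrite scaleN1r.
exists X; split=> //.
apply: (same_transformation_mkLam (t := Lam st su)) => //.
have tt : eqM (Lam su st) (Lam st su).
  move=> a z az; have := bL su su a z az.
  rewrite /bminus /chb /= !lfE expr0 mul1r => /eqP.
  by rewrite subr_eq0 => /eqP.
by move=> [|k||k||] [|l||l||] //=; rewrite ?opprK //; exact: Ldeg.
Qed.

(** A constant t has no effect, so it may be taken to be 0. *)
Lemma transformation_symmetry X : hol_transformation X ->
  exists Lam : bfam M, [/\ in_F 1 Lam, bzero (bminus Lam) & same_transformation Lam X].
Proof.
move=> hX; have [[[sA10 t10] h10] [[s01 t01] a01]] := hX.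
pose Ab j := - X (inr j).
exists (mkLam (fun i => X (inl i)) Ab 0).
have aAb : antihol_vf Ab.
  by apply: antihol_vf_congr (antihol_vfZ (-1) hX.2) => j; rewrite scaleN1r.
have z10 : smooth_vf10 (fun=> 0 : lfun M).
  split=> [i|a b p i _ _]; first exact: smoothM0.
  by rewrite lf0 big1 // => k _; rewrite lf0 mulr0.
have z01 : smooth_vf01 (fun=> 0 : lfun M).
  split=> [i|a b p i _ _]; first exact: smoothM0.
  by rewrite lf0 big1 // => k _; rewrite lf0 mulr0.
have z0 : smooth_fun (0 : lfun M) by split; first exact: smoothM0.
have zh : is_hol (0 : lfun M) by move=> k; rewrite pdbar0.
have za : is_antihol (0 : lfun M) by move=> k; rewrite pd0.
split.
- split; first by case=> [|k||k||] [|l||l||].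
  split; first by case=> [|k||k||] [|l||l||].
  split; first by move=> c [|l||l||] [] -> // _; exact: hX.1.1.
  split; first by move=> [|l||l||] c // _ [] -> //; exact: aAb.1.
  split.
    move=> c c' [] -> [] ->; split=> [i j|a b p i j _ _]; try exact: smoothM0;
    by rewrite big1 // => k _; rewrite big1 // => m _; exact: mulr0.
  split; first by move=> [|l||l||] [|k||k||] // _; exact: aAb.2.
  split; first by move=> [|l||l||] [|k||k||] // _; exact: hX.1.2.
  by move=> [|l||l||] [|k||k||] // _ _; exists 0.
- by rewrite bminus_mkLam.
- by apply: (same_transformation_mkLam (t := 0)).
Qed.

End Transformations.

Theorem theorem4 (R : realType) (n : nat) (M : complex_manifold R n)
    (Phi0' : lfun M)
    (hvol : volume_potential Phi0') (hpluri : pluriharmonic Phi0') :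
  let f' := (- 2) *: Phi0' in
  (* the Maurer-Cartan equation *)
  (forall (g : 'I_n -> 'I_n -> lfun M) (phi phibar : lfun M),
     smooth_bivector g -> hol_fun phi -> antihol_fun phibar ->
     let f := log_density Phi0' phi phibar in
     (* v and vbar are auxiliary *)
     (forall vbar v : 'I_n -> lfun M, antihol_vf vbar -> hol_vf v ->
        maurer_cartan f' (mkPsi g vbar v phi phibar) ->
        (forall i, eqM (v i) (2^-1 *: divg f g (inl i))) /\
        (forall j, eqM (vbar j) (- (2^-1 *: divg f g (inr j))))) /\
     (* the conditions imposed on g, phi, phibar *)
     ((exists vbar v : 'I_n -> lfun M,
         [/\ antihol_vf vbar, hol_vf v &
             maurer_cartan f' (mkPsi g vbar v phi phibar)])
      <->
      [/\ pluriharmonic (Phi0' + phi - phibar) /\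
          hol_vf (fun i => divg f g (inl i)) /\
          antihol_vf (fun j => divg f g (inr j)),
          forall I J, eqM (bivec (dbracket g g) I J
                           + lie_bivec (divg f g) (bivec g) I J) 0
        & eqM (divdivg f g) 0]))
  /\
  (* the infinitesimal symmetries *)
  (let same_transformation (Lam : bfam M) (X : 'I_n + 'I_n -> lfun M) :=
     forall (g : 'I_n -> 'I_n -> lfun M) (vbar v : 'I_n -> lfun M)
            (phi phibar : lfun M),
       smooth_bivector g -> antihol_vf vbar -> hol_vf v ->
       hol_fun phi -> antihol_fun phibar ->
       let dPsi := symmetry f' Lam (mkPsi g vbar v phi phibar) in
       (forall I J, eqM (bivec (g_comp dPsi) I J) (lie_bivec X (bivec g) I J)) /\
       eqM (density_variation Phi0' phi phibar (phi_comp dPsi) (phibar_comp dPsi))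
           (lie_vol X (density (log_density Phi0' phi phibar))) in
   (forall Lam : bfam M, in_F 1 Lam -> bzero (bminus Lam) ->
      exists X : 'I_n + 'I_n -> lfun M,
        hol_transformation X /\ same_transformation Lam X) /\
   (forall X : 'I_n + 'I_n -> lfun M, hol_transformation X ->
      exists Lam : bfam M,
        [/\ in_F 1 Lam, bzero (bminus Lam) & same_transformation Lam X])).
Proof.
have [sPhi _] := hvol.
split; first exact: maurer_cartan_conditions.
split; [exact: symmetry_transformation|exact: transformation_symmetry].
Qed.
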